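(* Let $A\in\mathbb C^{4\times4}$. Then $A$ is unitarily irreducible with $k(A)=4$ if and only if, up to a rotation, $A$ is unitarily similar to $H+iK$ with $H,K$ Hermitian, where for some real $h_1\ne h_2$ either (a) $$H=\begin{bmatrix}h_1&0&0&0\\0&h_1&0&0\\0&0&h_2&0\\0&0&0&h_2\end{bmatrix},\qquad K=\begin{bmatrix}k_{11}&k_{12}&\sigma_1&0\\ \overline{k_{12}}&k_{22}&0&\sigma_2\\ \sigma_1&0&k_{33}&k_{34}\\0&\sigma_2&\overline{k_{34}}&k_{44}\end{bmatrix}=:\begin{bmatrix}K_1&\Sigma\\ \Sigma&K_2\end{bmatrix},$$ with $\sigma_1>0$, $\sigma_1\ge\sigma_2\ge0$, $k_{12}k_{34}\ne0$ if $\sigma_2=0$, $K_1$ not commuting with $K_2$ if $\sigma_1=\sigma_2$, and at least one of the entries $k_{12},k_{34}$ different from zero if $\sigma_1>\sigma_2>0$; or (b) $$H=\begin{bmatrix}h_1&0&0&0\\0&h_1&0&0\\0&0&h_1&0\\0&0&0&h_2\end{bmatrix},\qquad K=\begin{bmatrix}k_1&0&0&b_1\\0&k_2&0&b_2\\0&0&k_3&b_3\\ b_1&b_2&b_3&k_4\end{bmatrix}\in\mathbb R^{4\times4},$$ with pairwise distinct $k_1,k_2,k_3$ and non-zero $b_1,b_2,b_3$.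
   Context: For $A\in\mathbb C^{n\times n}$ let $f_A(x)=\langle Ax,x\rangle$ on the unit sphere of $\mathbb C^n$; the numerical range $W(A)$ is the image of $f_A$, and the Gau--Wu number $k(A)$ is the maximal number of orthonormal vectors $x_j\in\mathbb C^n$ with $f_A(x_j)\in\partial W(A)$. $A$ is unitarily irreducible if no subspace of $\mathbb C^n$ other than $\{0\}$ and $\mathbb C^n$ is invariant under both $A$ and $A^*$. ''Up to a rotation, $A$ is unitarily similar to $B$'' means that $e^{i\theta}A$ is unitarily similar to $B$ for some real $\theta$. *)

(* Defs.v *)
From HB Require Import structures.
From mathcomp Require Import all_boot all_order all_algebra.
From mathcomp Require Import complex.
From mathcomp Require Import all_classical all_reals all_analysis.

Set Implicit Arguments.
Unset Strict Implicit.
Unset Printing Implicit Defensive.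

Import Order.TTheory GRing.Theory Num.Theory numFieldNormedType.Exports.
Local Open Scope classical_set_scope.
Local Open Scope complex_scope.
Local Open Scope sesquilinear_scope.
Local Open Scope ring_scope.

Definition frontier {T : topologicalType} (S : set T) : set T :=
  closure S `\` interior S.

Section NumericalRange.
Context {R : realType} {n : nat}.
Implicit Types (A B : 'M[R[i]]_n) (x y : 'cV[R[i]]_n).

(* Linear in the first argument, conjugate-linear in the second. *)
Definition inner x y : R[i] := (y^t* *m x) 0 0.

Definition quad A x : R[i] := inner (A *m x) x.

Definition numerical_range A : set R[i] :=
  [set quad A x | x in [set x | inner x x = 1]].

(* The cast selects the topology of the modulus on R[i]. *)
Definition numerical_range_boundary A : set R[i] :=
  frontier (numerical_range A : set (R[i] : numFieldType)).

Definition orthonormal (k : nat) (x : 'I_k -> 'cV[R[i]]_n) : Prop :=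
  forall i j, inner (x i) (x j) = (i == j)%:R.

Definition boundary_family A (k : nat) (x : 'I_k -> 'cV[R[i]]_n) : Prop :=
  orthonormal x /\ forall j, numerical_range_boundary A (quad A (x j)).

Lemma orthonormal_size k (x : 'I_k -> 'cV[R[i]]_n) :
  orthonormal x -> (k <= n)%N.
Proof.
move=> ox; pose M : 'M[R[i]]_(k, n) := \matrix_i (x i)^T.
have uM : M \is unitarymx.
  apply/unitarymxP/matrixP => i j; rewrite [RHS]mxE -ox /inner !mxE.
  by apply: eq_bigr => l _; rewrite !mxE mulrC.
by rewrite -(mxrank_unitary uM) rank_leq_col.
Qed.

(* Bounding k by n loses nothing, by orthonormal_size. *)
Definition gau_wu A : nat :=
  \max_(k < n.+1 | `[< exists x : 'I_k -> 'cV[R[i]]_n, boundary_family A x >]) k.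

Definition unitarily_irreducible A : Prop :=
  forall U : {vspace 'cV[R[i]]_n},
    (forall x, x \in U -> A *m x \in U) ->
    (forall x, x \in U -> A^t* *m x \in U) ->
    U = 0%VS \/ U = fullv.

Definition unitarily_similar A B : Prop :=
  exists2 U : 'M[R[i]]_n, U \is unitarymx & B = U^t* *m A *m U.

End NumericalRange.

Section NormalForms.
Context {R : realType}.

Definition expi (theta : R) : R[i] := cos theta +i* sin theta.

Definition mx_of_rows {T : nmodType} (m n : nat) (s : seq (seq T)) :
    'M[T]_(m, n) :=
  \matrix_(i < m, j < n) nth 0 (nth [::] s i) j.

(* The diagonal entries of K1 and K2 are real as soon as K is Hermitian. *)
Definition form_a (h1 h2 : R) (H K : 'M[R[i]]_4) : Prop :=
  exists (k11 k22 k33 k44 k12 k34 : R[i]) (sigma1 sigma2 : R),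
    let K1 := mx_of_rows 2 2 [:: [:: k11; k12]; [:: k12^*; k22]] in
    let K2 := mx_of_rows 2 2 [:: [:: k33; k34]; [:: k34^*; k44]] in
    let Sigma := mx_of_rows 2 2 [:: [:: sigma1%:C; 0]; [:: 0; sigma2%:C]] in
    [/\ H = block_mx (h1%:C)%:M 0 0 (h2%:C)%:M :> 'M[R[i]]_(2 + 2),
        K = block_mx K1 Sigma Sigma K2 :> 'M[R[i]]_(2 + 2),
        [/\ 0 < sigma1, sigma2 <= sigma1 & 0 <= sigma2] &
        [/\ sigma2 = 0 -> k12 * k34 != 0,
            sigma1 = sigma2 -> ~ comm_mx K1 K2 &
            sigma2 < sigma1 -> 0 < sigma2 -> k12 != 0 \/ k34 != 0]].

Definition form_b (h1 h2 : R) (H K : 'M[R[i]]_4) : Prop :=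
  exists k1 k2 k3 k4 b1 b2 b3 : R,
    [/\ H = map_mx (real_complex R)
              (mx_of_rows 4 4 [:: [:: h1; 0; 0; 0];
                                  [:: 0; h1; 0; 0];
                                  [:: 0; 0; h1; 0];
                                  [:: 0; 0; 0; h2]]),
        K = map_mx (real_complex R)
              (mx_of_rows 4 4 [:: [:: k1; 0; 0; b1];
                                  [:: 0; k2; 0; b2];
                                  [:: 0; 0; k3; b3];
                                  [:: b1; b2; b3; k4]]),
        [/\ k1 != k2, k1 != k3 & k2 != k3] &
        [/\ b1 != 0, b2 != 0 & b3 != 0]].

End NormalForms.

(* Main.v *)
Require Import Defs.
From HB Require Import structures.
From mathcomp Require Import all_boot all_order all_algebra.
From mathcomp Require Import complex.
From mathcomp Require Import all_classical all_reals all_analysis.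
From mathcomp Require Import ring lra.

(** Suppose that the orthonormal basis [x_1, ..., x_4] lies over the boundary of
    the numerical range of an irreducible matrix [A].  The numerical range is
    convex ([numerical_range_convex], the Toeplitz-Hausdorff theorem), so it has
    a supporting line at [<A x_j, x_j>]: for some [c_j] of modulus one, [x_j]
    maximises [Re (c_j <A y, y>)] on the unit sphere ([boundary_support]), and
    it is therefore an eigenvector of the Hermitian part of [c_j A]
    ([maximizes_eigen]).  In the basis [x] this says
    [c_j a_kj = - conj (c_j a_jk)] for [k <> j].  Comparing with the same
    identity for the pair [(k, j)] shows that the diagonal matrix of the squares
    [c_j^2] commutes with [A] and its adjoint.  By Schur's lemma
    ([irreducible_scalar]) it is scalar, so all the [c_j] agree up to sign
    ([boundary_basis_direction]).

    After one rotation, the Hermitian part [H] of [A] is thus diagonal in the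
    basis [x], and each of its diagonal entries is its largest or its smallest
    eigenvalue.  They are not all equal, as [A] would then be normal, hence
    reducible.  So [H] has exactly two eigenvalues, with multiplicities two and
    two or three and one.  Conversely, any orthonormal basis of eigenvectors of
    such an [H] lies over the boundary ([maximizes_boundary]).

    What remains is to reduce the other Hermitian part [K] by the unitary
    matrices that commute with [H], which are block diagonal.  For
    multiplicities two and two, a singular value decomposition of the
    off-diagonal block of [K] leads to [form_a]; for multiplicities three and
    one, the spectral theorem for the corner block and a choice of phases lead
    to [form_b].  In both cases irreducibility means that only scalar matrices
    commute with [H] and [K] ([irreducible_cartesianP]), and the conditions on
    the parameters say exactly this: [formA_commutant], [formA_conditions],
    [formB_commutant] and [formB_conditions]. *)

Set Implicit Arguments.
Unset Strict Implicit.
Unset Printing Implicit Defensive.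

Import Order.TTheory GRing.Theory Num.Theory numFieldNormedType.Exports.
Local Open Scope complex_scope.
Local Open Scope sesquilinear_scope.
Local Open Scope ring_scope.

(** * Irreducibility and the commutant *)

Section Commutant.
Context {R : realType}.
Local Notation C := R[i].

Lemma adjM m n p (A : 'M[C]_(m, n)) (B : 'M[C]_(n, p)) :
  (A *m B)^t* = B^t* *m A^t*.
Proof. by rewrite trmx_mul map_mxM. Qed.

Lemma adjD m n (A B : 'M[C]_(m, n)) : (A + B)^t* = A^t* + B^t*.
Proof. by rewrite linearD map_mxD. Qed.

Lemma adjZ m n c (A : 'M[C]_(m, n)) : (c *: A)^t* = c^* *: A^t*.
Proof. by rewrite linearZ map_mxZ. Qed.

Lemma hermE n (A : 'M[C]_n) : (A \is hermsymmx) = (A == A^t*).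
Proof. by rewrite is_hermitianmxE expr0 scale1r. Qed.

Lemma unitarymx_mulC n (U : 'M[C]_n) : U \is unitarymx -> U^t* *m U = 1%:M.
Proof. by move/unitarymxP/mulmx1C. Qed.

Definition kernelv n (M : 'M[C]_n) : {vspace 'cV[C]_n} :=
  lker (linfun (mulmx M)).

Lemma mem_kernelv n (M : 'M[C]_n) (x : 'cV[C]_n) :
  (x \in kernelv M) = (M *m x == 0).
Proof. by rewrite memv_ker lfunE. Qed.

Lemma mulmx_cV_inj m n (A B : 'M[C]_(m, n)) :
  (forall x : 'cV_n, A *m x = B *m x) -> A = B.
Proof.
move=> AB; apply/matrixP => i j.
by have /colP/(_ i) := AB (delta_mx j 0); rewrite -!colE !mxE.
Qed.

(** Schur's lemma: the eigenspaces of [P] are invariant under [A] and its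
    adjoint. *)
Lemma irreducible_scalar n (A P : 'M[C]_n.+1) : unitarily_irreducible A ->
  A *m P = P *m A -> A^t* *m P = P *m A^t* -> is_scalar_mx P.
Proof.
move=> irrA AP ASP; have [a /eigenvalueP[v vP v0]] :=
  eigenvalue_closed P^T (ltn0Sn n).
have stab (B : 'M[C]_n.+1) x : B *m P = P *m B ->
    x \in kernelv (P - a%:M) -> B *m x \in kernelv (P - a%:M).
  move=> BP; rewrite !mem_kernelv => /eqP Px.
  have -> : (P - a%:M) *m (B *m x) = B *m ((P - a%:M) *m x).
    by rewrite !mulmxA mulmxBl mulmxBr BP mul_scalar_mx mul_mx_scalar.
  by rewrite Px mulmx0.
have vU : v^T \in kernelv (P - a%:M).
  rewrite mem_kernelv mulmxBl mul_scalar_mx -[P]trmxK -trmx_mul vP.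
  by rewrite linearZ /= subrr.
case: (irrA _ (fun x => @stab A x AP) (fun x => @stab _ x ASP)) => U0.
  move: vU; rewrite U0 memv0 -trmx0 (inj_eq trmx_inj) => /eqP v0'.
  by rewrite v0' eqxx in v0.
apply/is_scalar_mxP; exists a; apply: mulmx_cV_inj => x; apply/eqP.
by rewrite -subr_eq0 -mulmxBl -mem_kernelv U0 memvf.
Qed.

(** The transposes of the vectors of [U] form the row space of a matrix [Q]
    with orthonormal rows, and [Q^* Q] projects rows onto it. *)
Lemma orthogonal_projector n (U : {vspace 'cV[C]_n}) :
  exists P : 'M[C]_n, [/\ P^t* = P, P *m P = P &
    forall x, (x \in U) = (P *m x == x)].
Proof.
pose W : 'M[C]_(\dim U, n) := \matrix_i ((vbasis U)`_i)^T.
have rowW i : row i W = ((vbasis U)`_i)^T by rewrite rowK.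
have WU x : (x \in U) = (x^T <= W)%MS.
  apply/idP/idP => [xU|/submxP[D xD]].
    rewrite (coord_vbasis xU) linear_sum summx_sub // => i _.
    by rewrite linearZ scalemx_sub //= -rowW row_sub.
  rewrite -[x]trmxK xD mulmx_sum_row linear_sum memv_suml // => i _.
  by rewrite linearZ /= rowW trmxK memvZ // vbasis_mem // mem_nth // size_tuple.
pose Q := schmidt (row_base W).
have uQ : Q *m Q^t* = 1%:M by apply/unitarymxP/schmidt_unitarymx/rank_leq_col.
have QW : (Q :=: W)%MS.
  exact: eqmx_trans (eqmx_schmidt_free (row_base_free W)) (eq_row_base W).
exists (Q^t* *m Q)^T; split=> [||x].
- by rewrite trmxK trmx_mul map_mxM map_mxCK map_trmx trmxK.
- by rewrite -trmx_mul mulmxA -[Q^t* *m Q *m Q^t*]mulmxA uQ mulmx1.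
rewrite WU -QW -(inj_eq trmx_inj) trmx_mul trmxK mulmxA.
apply/idP/eqP => [/submxP[D ->]|<-]; last exact: submxMl.
by rewrite -[D *m Q *m _]mulmxA uQ mulmx1.
Qed.

(** For the converse of Schur's lemma the orthogonal projector onto an
    invariant subspace lies in the commutant: invariance under [A] gives
    [P A P = A P], invariance under [A^*] gives the adjoint identity. *)
Lemma irreducible_of_commutant n (A : 'M[C]_n) :
  (forall P, A *m P = P *m A -> A^t* *m P = P *m A^t* -> is_scalar_mx P) ->
  unitarily_irreducible A.
Proof.
move=> comA U UA UAS; have [P [PS PP PU]] := orthogonal_projector U.
have inv B : (forall x, x \in U -> B *m x \in U) -> P *m B *m P = B *m P.
  move=> UB; apply: mulmx_cV_inj => x; apply/eqP.
  by rewrite -!mulmxA -PU UB // PU mulmxA PP.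
have invS B : (forall x, x \in U -> B *m x \in U) ->
    P *m B^t* *m P = P *m B^t*.
  by move/inv/(congr1 (fun M => M^t* )); rewrite !adjM PS mulmxA.
have PA := invS _ UA; have := invS _ UAS; rewrite trmxCK => PAS.
have /is_scalar_mxP[c Pc] : is_scalar_mx P.
  by apply: comA; rewrite -inv // ?PA ?PAS.
have [c0|c0] := eqVneq c 0; [left|right].
  apply/vspaceP => x; rewrite PU Pc mul_scalar_mx c0 scale0r memv0.
  by rewrite eq_sym.
apply/vspaceP => x; rewrite memvf; have: P *m x \in U by rewrite PU mulmxA PP.
by rewrite Pc mul_scalar_mx => /(memvZ c^-1); rewrite scalerA mulVf // scale1r.
Qed.

Definition trivial_commutant n (H K : 'M[C]_n) := forall P : 'M[C]_n,
  H *m P = P *m H -> K *m P = P *m K -> is_scalar_mx P.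

Lemma comm_lincomb n (a b : C) (X Y P : 'M[C]_n) :
  X *m P = P *m X -> Y *m P = P *m Y ->
  (a *: X + b *: Y) *m P = P *m (a *: X + b *: Y).
Proof.
by move=> XP YP; rewrite mulmxDl mulmxDr -!scalemxAl -!scalemxAr XP YP.
Qed.

(** [H] and [K] are linear combinations of [H + i K] and its adjoint, and
    conversely, so both pairs have the same commutant. *)
Lemma irreducible_cartesianP n (H K : 'M[C]_n.+1) :
  H \is hermsymmx -> K \is hermsymmx ->
  unitarily_irreducible (H + 'i%C *: K) <-> trivial_commutant H K.
Proof.
rewrite !hermE => /eqP hH /eqP hK.
have E1 : H + 'i%C *: K = 1 *: H + 'i%C *: K by rewrite scale1r.
have E2 : (H + 'i%C *: K)^t* = 1 *: H + (- 'i%C) *: K.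
  by rewrite adjD adjZ -hH -hK scale1r complexiE conjCi.
split=> [irr P HP KP|com].
  apply: irreducible_scalar irr _ _; rewrite ?E2 ?E1; exact: comm_lincomb.
apply: irreducible_of_commutant => P; rewrite E2 E1 => e1 e2.
have two : 2 != 0 :> C by rewrite pnatr_eq0.
have i0 : 'i%C != 0 :> C by rewrite complexiE neq0Ci.
set X := 1 *: H + _ in e1; set Y := 1 *: H + _ in e2.
have HE : H = 2^-1 *: X + 2^-1 *: Y.
  rewrite /X /Y -scalerDr scaleNr !scale1r addrACA subrr addr0 -mulr2n.
  by rewrite -[H *+ 2]scaler_nat scalerA mulVf // scale1r.
have KE : K = (2 * 'i%C)^-1 *: X + (- (2 * 'i%C)^-1) *: Y.
  rewrite /X /Y scaleNr -scalerBr !scale1r opprD addrACA subrr add0r scaleNr.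
  rewrite opprK -mulr2n -[_ *: K *+ 2]scaler_nat !scalerA mulVf ?scale1r //.
  by rewrite mulf_neq0.
apply: com; first by rewrite HE; exact: comm_lincomb.
by rewrite KE; exact: comm_lincomb.
Qed.

Lemma adj_unitary n (U : 'M[C]_n) : U \is unitarymx -> U^t* \is unitarymx.
Proof. by rewrite trmxC_unitary. Qed.

Lemma unitarily_similar_trans n (A B D : 'M[C]_n) :
  unitarily_similar A B -> unitarily_similar B D -> unitarily_similar A D.
Proof.
move=> [U uU ->] [V uV ->]; exists (U *m V); first exact: (mul_unitarymx uU uV).
by rewrite (adjM U V) !mulmxA.
Qed.

Lemma unitarily_similar_sym n (A B : 'M[C]_n) :
  unitarily_similar A B -> unitarily_similar B A.
Proof.
move=> [U uU ->]; exists (U^t* ); first by rewrite trmxC_unitary.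
rewrite trmxCK !mulmxA (unitarymxP uU) mul1mx -mulmxA (unitarymxP uU).
by rewrite mulmx1.
Qed.

Lemma irreducible_similar n (A B : 'M[C]_n.+1) :
  unitarily_similar A B -> unitarily_irreducible A -> unitarily_irreducible B.
Proof.
move=> [U uU ->] irrA; apply: irreducible_of_commutant => P.
have UU := unitarymxP uU; have UsU := unitarymx_mulC uU.
have tr X : U^t* *m X *m U *m P = P *m (U^t* *m X *m U) ->
    X *m (U *m P *m U^t*) = U *m P *m U^t* *m X.
  move/(congr1 (fun M => U *m M *m U^t*)); rewrite !mulmxA UU mul1mx => ->.
  by rewrite -[_ *m U *m _]mulmxA UU mulmx1.
move=> /tr e1; rewrite !adjM trmxCK mulmxA => /tr e2.
have /is_scalar_mxP[c Pc] := irreducible_scalar irrA e1 e2.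
apply/is_scalar_mxP; exists c.
have: U^t* *m (U *m P *m U^t*) *m U = U^t* *m c%:M *m U by rewrite Pc.
rewrite mul_mx_scalar -scalemxAl !mulmxA UsU mul1mx -mulmxA UsU mulmx1.
by rewrite scalemx1.
Qed.

Lemma irreducible_scale n (c : C) (A : 'M[C]_n.+1) : c != 0 ->
  unitarily_irreducible A -> unitarily_irreducible (c *: A).
Proof.
move=> c0 irrA; apply: irreducible_of_commutant => P.
rewrite adjZ -!scalemxAl -!scalemxAr => /(scalerI c0) e1.
have c0' : c^* != 0 by rewrite conjC_eq0.
by move=> /(scalerI c0') e2; exact: irreducible_scalar irrA e1 e2.
Qed.

Lemma commute_zero (a b z : C) : a != b -> a * z = z * b -> z = 0.
Proof.
move=> ab e; apply: (@mulfI _ (a - b)); first by rewrite subr_eq0.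
by rewrite mulr0 mulrBl e mulrC subrr.
Qed.

Lemma commute_diag_zero n (d : 'rV[C]_n) (P : 'M[C]_n) i j :
  diag_mx d *m P = P *m diag_mx d -> d 0 i != d 0 j -> P i j = 0.
Proof.
move=> /matrixP/(_ i j) e ij; apply: (commute_zero ij).
by move: e; rewrite mul_diag_mx mul_mx_diag !mxE.
Qed.

(** The projector onto a set of coordinates that [K] does not link to the
    others commutes with [K], and with any diagonal matrix. *)
Lemma trivial_commutant_connected n (d : 'rV[C]_n) (K : 'M[C]_n)
    (S : pred 'I_n) :
  trivial_commutant (diag_mx d) K ->
  (forall i j, K i j != 0 -> S i = S j) -> forall i j, S i = S j.
Proof.
move=> triv KS i j; pose P : 'M[C]_n := diag_mx (\row_k (S k)%:R).
have /is_scalar_mxP[a Pa] : is_scalar_mx P.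
  apply: triv; first exact: diag_mxC.
  apply/matrixP => k l; rewrite mul_mx_diag mul_diag_mx !mxE.
  have [->|/KS ->] := eqVneq (K k l) 0; first by rewrite mulr0 mul0r.
  exact: mulrC.
have e k : (S k)%:R = a by have /matrixP/(_ k k) := Pa; rewrite !mxE eqxx.
have /eqP := etrans (e i) (esym (e j)); rewrite eqr_nat.
by case: (S i) (S j) => [] [].
Qed.

(** A common eigenvector [v] of symmetric matrices puts [v v^T] into their
    commutant. *)
Lemma trivial_commutant_eigenvector n (H K : 'M[C]_n) (v : 'cV[C]_n) h k :
  trivial_commutant H K -> H^T = H -> K^T = K ->
  H *m v = h *: v -> K *m v = k *: v ->
  forall i j, i != j -> v i 0 * v j 0 = 0.
Proof.
move=> triv sH sK Hv Kv i j ij.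
have comm (M : 'M[C]_n) m : M^T = M -> M *m v = m *: v ->
    M *m (v *m v^T) = v *m v^T *m M.
  move=> sM Mv; rewrite mulmxA Mv -mulmxA.
  have -> : v^T *m M = m *: v^T by rewrite -[M]sM -trmx_mul Mv linearZ.
  by rewrite -scalemxAl -scalemxAr.
have /is_scalar_mxP[a /matrixP/(_ i j)] :=
  triv _ (comm _ _ sH Hv) (comm _ _ sK Kv).
by rewrite !mxE big_ord1 !mxE (negbTE ij).
Qed.

End Commutant.

(** * Supporting lines of convex sets in the plane *)

Section PlanarSupport.
Context {R : realType}.
Implicit Type S : R -> R -> Prop.

Definition planar_convex S := forall x y x' y' t, S x y -> S x' y' ->
  0 <= t <= 1 -> S ((1 - t) * x + t * x') ((1 - t) * y + t * y').

Definition surrounds0 S := exists2 e : R, 0 < e &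
  forall x y, `|x| < e -> `|y| < e -> S x y.

(** A point [(x, y)] near the origin with [y >= 0] lies on the segment from
    [(x1, y1)] to a point [(c, 0)] with [- s <= c <= r]. *)
Lemma surrounds0_upper S r s x1 y1 : planar_convex S ->
  0 < r -> 0 < s -> 0 < y1 -> S r 0 -> S (- s) 0 -> S x1 y1 ->
  exists2 e : R, 0 < e & forall x y, `|x| < e -> 0 <= y < e -> S x y.
Proof.
move=> cvx r0 s0 y10 Sr Ss S1.
pose m := Num.min r s; have m0 : 0 < m by rewrite lt_min r0.
have [mr ms] : m <= r /\ m <= s by rewrite !ge_min !lexx orbT.
(* With [t = y / y1 <= 1 / 2], the product [e * d] will bound
   [x - t * x1 = (1 - t) * c]. *)
pose d := 1 + `|x1| / y1.
have d0 : 0 < d by rewrite ltr_wpDr // divr_ge0 // ltW.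
pose e := Num.min (y1 / 2) (m / 2 / d).
have e0 : 0 < e by rewrite lt_min !divr_gt0.
have [ey em] : e <= y1 / 2 /\ e <= m / 2 / d by rewrite !ge_min !lexx orbT.
exists e => // x y xe /andP[y0 ye].
pose t := y / y1.
have t0 : 0 <= t by rewrite divr_ge0 // ltW.
have tE : t * y1 = y by rewrite divfK // gt_eqF.
have t2 : t <= 2^-1.
  by rewrite ler_pdivrMr // (le_trans (ltW ye)) // mulrC.
pose c := (x - t * x1) / (1 - t).
have t1 : 0 < 1 - t by lra.
have cE : (1 - t) * c = x - t * x1 by rewrite mulrC divfK // gt_eqF.
have cm : `|x - t * x1| <= m / 2.
  apply: le_trans (ler_normB _ _) _.
  have -> : m / 2 = m / 2 / d * d by rewrite divfK // gt_eqF.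
  apply: le_trans (_ : e * d <= _); last by rewrite ler_pM2r.
  rewrite mulrDr mulr1 lerD ?(ltW xe) // normrM (ger0_norm t0) /t.
  by rewrite mulrAC -mulrA ler_wpM2r // ?divr_ge0 // ltW.
have {}cm : - m <= c <= m.
  rewrite -ler_norml /c normrM normfV (gtr0_norm t1) ler_pdivrMr //.
  by apply: le_trans cm _; nra.
have Sc : S c 0.
  pose u := (c + s) / (r + s).
  have rs : 0 < r + s by rewrite addr_gt0.
  have uE : u * (r + s) = c + s by rewrite divfK // gt_eqF.
  have -> : c = (1 - u) * - s + u * r by lra.
  have -> : 0 = (1 - u) * 0 + u * 0 :> R by rewrite !mulr0 addr0.
  apply: cvx => //; apply/andP; split; first by rewrite divr_ge0; lra.
  by rewrite ler_pdivrMr //; lra.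
have -> : x = (1 - t) * c + t * x1 by rewrite cE subrK.
have -> : y = (1 - t) * 0 + t * y1 by rewrite mulr0 add0r.
by apply: cvx => //; lra.
Qed.

Lemma planar_convex_flip S : planar_convex S ->
  planar_convex (fun x y => S x (- y)).
Proof.
move=> cvx x y x' y' t Sxy Sxy' t01.
by rewrite opprD -!mulrN; exact: cvx.
Qed.

(** The axis point [(r, 0)] reduces the search for a supporting line to one
    parameter, its slope: the points of [S] above and below the axis bound
    that slope from opposite sides, and the bounds are compatible unless a
    segment joining two such points meets the negative half-axis. *)
Lemma planar_support_axis S r : planar_convex S -> 0 < r -> S r 0 ->
  (forall a b, (a, b) != (0, 0) -> exists x y, S x y /\ 0 < a * x + b * y) ->
  surrounds0 S.
Proof.
move=> cvx r0 Sr noline.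
have [x1 [y1 [S1]]] : exists x y, S x y /\ 0 < 0 * x + 1 * y.
  by apply: noline; rewrite xpair_eqE oner_eq0 andbF.
rewrite mul0r add0r mul1r => y10.
have [x2 [y2 [S2]]] : exists x y, S x y /\ 0 < 0 * x + (- 1) * y.
  by apply: noline; rewrite xpair_eqE oppr_eq0 oner_eq0 andbF.
rewrite mul0r add0r mulN1r oppr_gt0 => y20.
have [s s0 Ss] : exists2 s, 0 < s & S (- s) 0.
  apply: contrapT => noneg.
  have axis x : S x 0 -> 0 <= x.
    move=> Sx; rewrite leNgt; apply/negP => x0; apply: noneg.
    by exists (- x); rewrite ?oppr_gt0 ?opprK.
  have cross x y x' y' : S x y -> S x' y' -> 0 < y -> y' < 0 ->
      x' / y' <= x / y.
    move=> Sxy Sxy' y0 y'0.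
    have yy : 0 < y - y' by rewrite subr_gt0 (lt_trans y'0).
    pose t := y / (y - y').
    have tE : t * (y - y') = y by rewrite divfK // gt_eqF.
    have t01 : 0 <= t <= 1.
      apply/andP; split; first by rewrite divr_ge0 // ltW.
      by rewrite ler_pdivrMr // mul1r lerDl oppr_ge0 ltW.
    have := cvx _ _ _ _ t Sxy Sxy' t01.
    have -> : (1 - t) * y + t * y' = 0 by lra.
    move/axis => h; have {h} : 0 <= ((1 - t) * x + t * x') * (y - y').
      by rewrite mulr_ge0 // ltW.
    have -> : ((1 - t) * x + t * x') * (y - y') = y * x' - y' * x.
      rewrite mulrDl -mulrA [x * _]mulrC mulrA mulrBl mul1r tE.
      by rewrite -mulrA [x' * _]mulrC mulrA tE; ring.
    rewrite subr_ge0 => h.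
    by rewrite ler_ndivrMr // mulrAC ler_pdivrMr // mulrC [_ * y]mulrC.
  pose E : set R := [set q | exists x y, [/\ S x y, 0 < y & q = x / y]]%classic.
  have Elb x' y' : S x' y' -> y' < 0 -> lbound E (x' / y').
    by move=> S' y'0 q [x [y [Sxy y0 ->]]]; exact: cross.
  have E0 : (E !=set0)%classic by exists (x1 / y1), x1, y1.
  have hE : has_lbound E by exists (x2 / y2); exact: Elb.
  (* The line [x = inf E * y] would be a supporting line. *)
  have [x [y [Sxy]]] : exists x y, S x y /\ 0 < (- 1) * x + inf E * y.
    by apply: noline; rewrite xpair_eqE oppr_eq0 oner_eq0.
  rewrite mulN1r addrC subr_gt0 => h.
  have [y0|y0|y0] := ltgtP y 0; last first.
  - by move: h Sxy; rewrite y0 mulr0 => h /axis; rewrite leNgt h.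
  - have : inf E <= x / y by apply: ge_inf => //; exists x, y.
    by rewrite ler_pdivlMr // leNgt h.
  - have : x / y <= inf E by apply: lb_le_inf => //; exact: Elb.
    by rewrite ler_ndivrMr // leNgt h.
have [e1 e10 up] := surrounds0_upper cvx r0 s0 y10 Sr Ss S1.
have [||||e2 e20 dn] :=
  surrounds0_upper (planar_convex_flip cvx) r0 s0 (y1 := - y2) (x1 := x2).
- by rewrite oppr_gt0.
- by rewrite oppr0.
- by rewrite oppr0.
- by rewrite opprK.
exists (Num.min e1 e2) => [|x y]; first by rewrite lt_min e10.
rewrite !lt_min => /andP[x1' x2'] /andP[]; have [y0|y0] := leP 0 y.
  by rewrite (ger0_norm y0) => h _; apply: up; rewrite ?y0.
rewrite (ltr0_norm y0) => _ h; rewrite -[y]opprK; apply: dn => //.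
by rewrite oppr_ge0 ltW.
Qed.

Lemma planar_support S : planar_convex S -> ~ surrounds0 S ->
  exists a b : R, (a, b) != (0, 0) /\ forall x y, S x y -> a * x + b * y <= 0.
Proof.
move=> cvx nS; apply: contrapT => noline.
have pos a b : (a, b) != (0, 0) -> exists x y, S x y /\ 0 < a * x + b * y.
  move=> ab; apply: contrapT => no; apply: noline.
  exists a, b; split=> // x y Sxy.
  by rewrite leNgt; apply/negP => h; apply: no; exists x, y.
have [u [v [Suv]]] : exists x y, S x y /\ 0 < 1 * x + 0 * y.
  by apply: pos; rewrite xpair_eqE oner_eq0.
rewrite mul1r mul0r addr0 => u0.
(* Complex multiplication by [u + i v] maps [(1, 0)] to the point [(u, v)] of
   [S], so the previous lemma applies to the preimage [T] of [S]. *)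
pose T x y := S (u * x - v * y) (v * x + u * y).
pose d := u ^+ 2 + v ^+ 2.
have d0 : 0 < d by rewrite ltr_pwDl ?exprn_gt0 ?sqr_ge0.
have dN : d != 0 by rewrite gt_eqF.
have SE x y : S x y = T ((u * x + v * y) / d) ((u * y - v * x) / d).
  by rewrite /T /d; congr S; field.
case: nS; have [|||e e0 eT] := @planar_support_axis T 1 _ ltr01.
- move=> x y x' y' t Txy Txy' t01; have := cvx _ _ _ _ _ Txy Txy' t01.
  by rewrite /T; congr S; ring.
- by rewrite /T !mulr0 !mulr1 subr0 addr0.
- move=> a b ab.
  have [|x [y [Sxy h]]] := pos (a * u - b * v) (a * v + b * u).
    apply: contraNneq ab => -[] e1 e2.
    have : d * a = 0.
      transitivity (u * (a * u - b * v) + v * (a * v + b * u)).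
        by rewrite /d; ring.
      by rewrite e1 e2 !mulr0 addr0.
    have : d * b = 0.
      transitivity (u * (a * v + b * u) - v * (a * u - b * v)).
        by rewrite /d; ring.
      by rewrite e1 e2 !mulr0 subr0.
    move/eqP; rewrite mulf_eq0 (negbTE dN) => /eqP -> /eqP.
    by rewrite mulf_eq0 (negbTE dN) => /eqP ->.
  exists ((u * x + v * y) / d), ((u * y - v * x) / d); rewrite -SE; split=> //.
  rewrite !mulrA -mulrDl divr_gt0 //.
  by have -> : a * (u * x + v * y) + b * (u * y - v * x) =
     (a * u - b * v) * x + (a * v + b * u) * y by ring.
pose n := 1 + `|u| + `|v|.
have n0 : 0 < n by rewrite /n -addrA ltr_wpDr // addr_ge0.
exists (e * d / n) => [|x y xe ye]; first by rewrite divr_gt0 ?mulr_gt0.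
have E0 : 0 < e * d / n by rewrite divr_gt0 ?mulr_gt0.
have bound (c c' : R) : `|c| + `|c'| < n -> `|(c * x + c' * y) / d| < e.
  move=> hc; rewrite normrM normfV (gtr0_norm d0) ltr_pdivrMr //.
  have -> : e * d = n * (e * d / n) by rewrite [n * _]mulrC divfK // gt_eqF.
  apply: (le_lt_trans (y := (`|c| + `|c'|) * (e * d / n))); last first.
    by rewrite ltr_pM2r.
  apply: le_trans (ler_normD _ _) _.
  by rewrite mulrDl !normrM lerD // ler_wpM2l // ltW.
rewrite SE; apply: eT; first by apply: bound; rewrite /n; lra.
have -> : u * y - v * x = - v * x + u * y by ring.
by apply: bound; rewrite normrN /n; lra.
Qed.

End PlanarSupport.

(** * Convexity of the numerical range *)

Section NumericalRangeConvexity.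
Context {R : realType} {n : nat}.
Local Notation C := R[i].
Implicit Types (A : 'M[C]_n) (x y z : 'cV[C]_n).

Lemma innerDl x y z : inner (x + y) z = inner x z + inner y z.
Proof. by rewrite /inner mulmxDr mxE. Qed.

Lemma innerDr x y z : inner z (x + y) = inner z x + inner z y.
Proof. by rewrite /inner adjD mulmxDl mxE. Qed.

Lemma innerZl c x y : inner (c *: x) y = c * inner x y.
Proof. by rewrite /inner -scalemxAr mxE. Qed.

Lemma innerZr c x y : inner x (c *: y) = c^* * inner x y.
Proof. by rewrite /inner adjZ -scalemxAl mxE. Qed.

Lemma innerE x y : inner x y = \sum_i (y i 0)^* * x i 0.
Proof. by rewrite /inner mxE; apply: eq_bigr => i _; rewrite !mxE. Qed.

Lemma innerC x y : inner x y = (inner y x)^*.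
Proof.
rewrite !innerE rmorph_sum; apply: eq_bigr => i _.
by rewrite rmorphM /= conjCK mulrC.
Qed.

Lemma inner_normE x : inner x x = \sum_i `|x i 0| ^+ 2.
Proof. by rewrite innerE; apply: eq_bigr => i _; rewrite normCKC. Qed.

Lemma inner_ge0 x : 0 <= inner x x.
Proof. by rewrite inner_normE sumr_ge0 // => i _; rewrite exprn_ge0. Qed.

Lemma inner_eq0 x : (inner x x == 0) = (x == 0).
Proof.
apply/idP/eqP => [|->]; last first.
  by rewrite inner_normE big1 // => i _; rewrite mxE normr0 expr0n.
rewrite inner_normE psumr_eq0 => [/allP h|i _]; last by rewrite exprn_ge0.
apply/colP => i; rewrite mxE; have := h i; rewrite mem_index_enum => /(_ isT).
by rewrite expf_eq0 normr_eq0 => /eqP.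
Qed.

Lemma inner_adj A x y : inner (A *m x) y = inner x (A^t* *m y).
Proof. by rewrite /inner adjM trmxCK mulmxA. Qed.

Lemma quadZ A c x : quad A (c *: x) = `|c| ^+ 2 * quad A x.
Proof. by rewrite /quad -scalemxAr innerZl innerZr mulrA -normCK. Qed.

Lemma inner_real x : (complex.Re (inner x x))%:C = inner x x.
Proof. by rewrite RRe_real // ger0_real // inner_ge0. Qed.

Lemma Re_inner_gt0 x : x != 0 -> 0 < complex.Re (inner x x).
Proof.
by move=> x0; rewrite -ltcR inner_real lt0r inner_eq0 x0 inner_ge0.
Qed.

Lemma unit_multiple x : x != 0 ->
  exists2 c : C, inner (c *: x) (c *: x) = 1 & `|c| ^+ 2 = (inner x x)^-1.
Proof.
move=> x0; exists (sqrtC (inner x x))^-1; rewrite ?innerZl ?innerZr ?mulrA.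
  by rewrite -normCK -normrX exprVn sqrtCK ger0_norm ?invr_ge0 ?inner_ge0 //
     mulVf // inner_eq0.
by rewrite -normrX exprVn sqrtCK ger0_norm // invr_ge0 inner_ge0.
Qed.

Lemma inner0l x : inner 0 x = 0.
Proof. by rewrite -(scale0r 0) innerZl mul0r. Qed.

Lemma quadD A x y :
  quad A (x + y) = quad A x + quad A y + inner (A *m x) y + inner (A *m y) x.
Proof. by rewrite /quad mulmxDr innerDl !innerDr; ring. Qed.

Lemma innerDD x y :
  inner (x + y) (x + y) = inner x x + inner y y + inner x y + inner y x.
Proof. by rewrite innerDl !innerDr; ring. Qed.

Lemma numerical_range_isotropic A zeta x : x != 0 ->
  quad A x = zeta * inner x x -> numerical_range A zeta.
Proof.
move=> x0 Ax; have [c c1 c2] := unit_multiple x0; exists (c *: x) => //.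
by rewrite quadZ c2 Ax mulrCA mulVf ?mulr1 // inner_eq0.
Qed.

(** The Toeplitz-Hausdorff theorem.  Let [zeta] divide the segment from [p] to
    [q] and [g v = <(A - zeta) v, v> / (q - p)]; on unit vectors [x], [y] over
    [p], [q] it takes the values [- t] and [1 - t].  A complex multiple [u x]
    makes the cross terms of [g (u x + b y)] real for every real [b], so that
    this is a real quadratic polynomial in [b], with nonnegative
    discriminant. *)
Lemma numerical_range_convex A p q (t : R) : 0 <= t <= 1 ->
  numerical_range A p -> numerical_range A q ->
  numerical_range A ((1 - t%:C) * p + t%:C * q).
Proof.
move=> /andP[t0 t1] [x /= x1 xp] [y /= y1 yq].
have [->|pq] := eqVneq p q.
  by rewrite -mulrDl subrK mul1r; exists y.
have [->|tN1] := eqVneq t 1; first by rewrite subrr mul0r mul1r add0r; exists y.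
have {}t1 : 0 < 1 - t by rewrite subr_gt0 lt_neqAle tN1.
set zeta := _ + _; pose delta := q - p.
have d0 : delta != 0 by rewrite subr_eq0 eq_sym.
pose alpha := (inner (A *m x) y - zeta * inner x y) / delta.
pose beta := (inner (A *m y) x - zeta * inner y x) / delta.
(* Unless it vanishes, [u = alpha^* - beta] works: the sum is then
   [|alpha|^2 - |beta|^2]. *)
have [u u0 [m mE]] : exists2 u : C, u != 0 &
    exists m : R, u * alpha + u^* * beta = m%:C.
  have [ab|ab] := eqVneq alpha^* beta.
    exists 1; first exact: oner_neq0.
    exists (complex.Re (alpha + beta)); rewrite rmorph1 !mul1r RRe_real //.
    by rewrite -ab; apply/CrealP; rewrite rmorphD /= conjCK addrC.
  exists (alpha^* - beta); first by rewrite subr_eq0.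
  exists (complex.Re (`|alpha| ^+ 2 - `|beta| ^+ 2)).
  rewrite RRe_real ?rpredB ?rpredX ?normr_real // !normCK rmorphB /= conjCK.
  by ring.
pose N := complex.Re (`|u| ^+ 2).
have NE : N%:C = `|u| ^+ 2 by rewrite RRe_real ?rpredX ?normr_real.
have N0 : 0 < N by rewrite -ltcR NE exprn_gt0 // normr_gt0.
(* [D] is the discriminant of the quadratic [bE] and [b] one of its roots. *)
pose D := m ^+ 2 + 4 * (t * N * (1 - t)).
have D0 : 0 <= D by rewrite addr_ge0 ?sqr_ge0 // !mulr_ge0 // ltW.
pose b := (Num.sqrt D - m) / (2 * (1 - t)).
have bE : (1 - t) * b ^+ 2 + m * b - t * N = 0.
  apply: (@mulfI _ (4 * (1 - t))); first by rewrite mulf_neq0 ?gt_eqF.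
  have e : 2 * (1 - t) * b = Num.sqrt D - m.
    by rewrite /b mulrC divfK // mulf_neq0 ?gt_eqF.
  have sE := sqr_sqrtr D0.
  transitivity ((2 * (1 - t) * b) ^+ 2 + 2 * m * (2 * (1 - t) * b)
                - 4 * (1 - t) * t * N).
    by ring.
  rewrite e mulr0.
  transitivity (Num.sqrt D ^+ 2 - m ^+ 2 - 4 * (1 - t) * t * N).
    by ring.
  by rewrite sE /D; ring.
have zE : quad A (u *: x + b%:C *: y) =
    zeta * inner (u *: x + b%:C *: y) (u *: x + b%:C *: y).
  apply/eqP; rewrite -subr_eq0; apply/eqP.
  have bb : b%:C^* = b%:C :> C by exact: conjc_real.
  have eA : inner (A *m x) y = delta * alpha + zeta * inner x y.
    by rewrite [delta * _]mulrC divfK // subrK.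
  have eB : inner (A *m y) x = delta * beta + zeta * inner y x.
    by rewrite [delta * _]mulrC divfK // subrK.
  rewrite quadD innerDD !quadZ -!scalemxAr !innerZl !innerZr.
  rewrite bb xp yq x1 y1 eA eB.
  have nb : `|b%:C| ^+ 2 = b%:C * b%:C by rewrite normCK bb.
  rewrite -NE nb.
  transitivity (delta * ((1 - t) * b ^+ 2 + m * b - t * N)%:C +
      zeta * (N%:C - u * u^*) + delta * b%:C * (u * alpha + u^* * beta - m%:C)).
    by rewrite /zeta /delta; ring.
  by rewrite bE mE -normCK NE !subrr !mulr0 !addr0.
(* A vanishing [u x + b y] would make [y] a multiple of [x], whence [p = q]. *)
apply: numerical_range_isotropic zE; apply: contra_neq pq => z0.
have b0 : b%:C != 0 :> C.
  apply: contraTneq u0 => b0; move: z0; rewrite b0 scale0r addr0 => /eqP.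
  by rewrite scaler_eq0 -inner_eq0 x1 oner_eq0 orbF negbK.
have yE : y = (- (u / b%:C)) *: x.
  apply: (scalerI b0); rewrite scalerA mulrN mulrC divfK // scaleNr.
  by apply/eqP; rewrite -addr_eq0 addrC z0.
move: y1 yq; rewrite yE innerZl innerZr x1 mulr1 quadZ xp normCK => ->.
by rewrite mul1r.
Qed.

End NumericalRangeConvexity.

(** * Boundary points and extremal directions *)

Section Angles.
Context {R : realType}.
Local Notation C := R[i].

Lemma expi_mulC (theta : R) : expi theta * (expi theta)^* = 1.
Proof.
apply/eqP; rewrite /expi eq_complex /= mulrN opprK -!expr2 cos2Dsin2 eqxx /=.
by rewrite mulrN mulrC addNr.
Qed.

Lemma expi_neq0 (theta : R) : expi theta != 0.
Proof.
apply: contra_eq_neq (expi_mulC theta) => ->.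
by rewrite mul0r eq_sym oner_neq0.
Qed.

Lemma polar_form (a b : R) : (a, b) != (0, 0) ->
  exists2 k : R, 0 < k &
  exists theta : R, a = k * cos theta /\ b = k * sin theta.
Proof.
move=> ab; pose d := a ^+ 2 + b ^+ 2.
have d0 : 0 < d.
  rewrite lt_neqAle addr_ge0 ?sqr_ge0 // andbT eq_sym paddr_eq0 ?sqr_ge0 //.
  by rewrite !sqrf_eq0 -xpair_eqE.
pose k := Num.sqrt d; have k0 : 0 < k by rewrite sqrtr_gt0.
have k2 : k ^+ 2 = d by rewrite sqr_sqrtr // ltW.
exists k => //; pose r := a / k.
have rE : a = k * r by rewrite mulrC divfK // gt_eqF.
have bE : b ^+ 2 = k ^+ 2 * (1 - r ^+ 2).
  by rewrite mulrBr mulr1 -exprMn -rE k2 /d; ring.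
have r2 : 0 <= 1 - r ^+ 2.
  by rewrite -(pmulr_rge0 _ (exprn_gt0 2 k0)) -bE sqr_ge0.
have r1 : -1 <= r <= 1 by apply/andP; split; nra.
have rI : r \in `[(-1), 1]%R by rewrite in_itv.
have sE : k * sin (acos r) = `|b|.
  rewrite sin_acos // -sqrtr_sqr bE sqrtrM ?sqr_ge0 // sqrtr_sqr gtr0_norm //.
have [b0|b0] := leP 0 b.
  by exists (acos r); rewrite acosK // sE ger0_norm.
by exists (- acos r); rewrite cosN sinN acosK // mulrN sE ltr0_norm ?opprK.
Qed.

End Angles.

Section BoundarySupport.
Context {R : realType} {n : nat}.
Local Notation C := R[i].
Implicit Types (A : 'M[C]_n) (x y z : 'cV[C]_n).

Definition maximizes A (c : C) x := forall y, inner y y = 1 ->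
  complex.Re (c * quad A y) <= complex.Re (c * quad A x).

Lemma Im_le_norm (z : C) : (`|complex.Im z|)%:C <= `|z|.
Proof.
have := normc_ge_Re (z * 'i%C).
by rewrite ReiNIm normrN normrM complexiE normCi mulr1.
Qed.

(** Any neighbourhood of [quad A x] contains points further away in the
    direction [c^*]. *)
Lemma maximizes_boundary A c x : inner x x = 1 -> c != 0 ->
  maximizes A c x -> numerical_range_boundary A (quad A x).
Proof.
move=> x1 c0 cx; split; first by apply: subset_closure; exists x.
rewrite /interior /= => /nbhs_ballP[e /= e0 eW].
have cn : `|c| != 0 by rewrite normr_eq0.
have [f f0 fe] : exists2 f : C, 0 < f & f < e.
  exists (e / 2); first by rewrite divr_gt0 // ltr0n.
  by rewrite ltr_pdivrMr ?ltr0n // ltr_pMr // ltr1n.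
pose w : C := quad A x + f * (c^* / `|c|).
have [|y y1 yw] := eW w.
  rewrite /ball /= /w opprD addrA subrr add0r normrN !normrM normfV norm_conjC.
  by rewrite normr_id mulfV // mulr1 gtr0_norm.
have := cx y y1; rewrite yw /w mulrDr raddfD /= gerDl leNgt => /negP; apply.
have -> : c * (f * (c^* / `|c|)) = f * `|c|.
  transitivity (f * (c * c^* / `|c|)); first by ring.
  by rewrite -normCK expr2 mulfK.
rewrite -ltcR RRe_real; first by rewrite mulr_gt0 // normr_gt0.
by rewrite realM // ?normr_real // gtr0_real.
Qed.

(** The converse of [maximizes_boundary]: a supporting line of the convex set
    [numerical_range A] at [quad A x], read as a direction. *)
Lemma boundary_support A x : inner x x = 1 ->
  numerical_range_boundary A (quad A x) ->
  exists theta, maximizes A (expi theta) x.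
Proof.
move=> x1 [_ nint].
pose S (u v : R) := numerical_range A (quad A x + (u +i* v)).
have cvx : planar_convex S.
  move=> u v u' v' t Su Su' t01; have := numerical_range_convex t01 Su Su'.
  rewrite /S; congr (numerical_range A _).
  case: (quad A x) => a b; apply/eqP; rewrite eq_complex /=.
  by apply/andP; split; apply/eqP; ring.
have [|a [b [ab supp]]] := planar_support cvx.
  move=> [e e0 Se]; apply: nint; apply/nbhs_ballP; exists e%:C => /=.
    by rewrite ltcR.
  move=> z; rewrite /ball /= distrC => ze.
  have := Se (complex.Re (z - quad A x)) (complex.Im (z - quad A x)).
  rewrite -!ltcR !(le_lt_trans (normc_ge_Re _) ze,
                   le_lt_trans (Im_le_norm _) ze) => /(_ isT isT).
  rewrite /S; case: (z - quad A x) (subrK (quad A x) z) => u v.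
  by rewrite addrC => ->.
have [|k k0 [theta [aE bE]]] := @polar_form R a (- b).
  by apply: contra ab; rewrite !xpair_eqE oppr_eq0.
exists theta => y y1.
have := supp (complex.Re (quad A y - quad A x))
             (complex.Im (quad A y - quad A x)).
rewrite /S; have -> : quad A x + (complex.Re (quad A y - quad A x)
    +i* complex.Im (quad A y - quad A x)) = quad A y.
  by rewrite -[RHS](subrK (quad A x)) addrC; case: (quad A y - _).
move=> /(_ (ex_intro2 _ _ y y1 erefl)) le0.
rewrite -subr_le0 -raddfB -mulrBr -(pmulr_rle0 _ k0); apply: le_trans le0.
rewrite aE -[b]opprK bE; case: (quad A y - quad A x) => u v.
by rewrite /expi /= le_eqVlt; apply/orP; left; apply/eqP; ring.
Qed.

(** Moving from [x] along [- A x] by a small step would make the quadratic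
    form negative. *)
Lemma psd_isotropic_kernel A x : A^t* = A ->
  (forall y, 0 <= quad A y) -> quad A x = 0 -> A *m x = 0.
Proof.
move=> hA psd qx; apply/eqP; rewrite -inner_eq0; apply/eqP.
set z := A *m x; pose a := inner z z; pose b := quad A z.
have a0 : 0 <= a by exact: inner_ge0.
have b0 : 0 <= b by exact: psd.
have b1 : 0 < b + 1 by rewrite ltr_wpDl.
(* With [t (b + 1) = a] the form at [x - t z] equals [- t a - t^2]. *)
pose t := a / (b + 1); have tE : t * (b + 1) = a by rewrite divfK // gt_eqF.
have t0 : 0 <= t by rewrite divr_ge0 // ltW.
have tr : t^* = t by apply/CrealP/ger0_real.
have := psd (x + (- t) *: z).
rewrite quadD quadZ normrN qx add0r -scalemxAr innerZl innerZr rmorphN /= tr.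
rewrite normCK tr -/b -/z -/a.
have -> : inner (A *m z) x = a by rewrite inner_adj hA.
have -> : t * t * b + - t * a + - t * a = - (t * a) - t * t.
  by rewrite -{1 2 3}tE; ring.
rewrite -opprD oppr_ge0 => le0.
have ta : 0 <= t * a by rewrite mulr_ge0.
have tt : 0 <= t * t by rewrite mulr_ge0.
have : t * t == 0.
  by rewrite eq_le tt andbT (le_trans _ le0) // lerDr.
by rewrite mulf_eq0 orbb => /eqP tz; rewrite -/a -tE tz mul0r.
Qed.

Lemma Re_adj (z : C) : 2 * (complex.Re z)%:C = z + z^*.
Proof. by rewrite addcJ. Qed.

Lemma ReZ (k : R) (z : C) : complex.Re (k%:C * z) = k * complex.Re z.
Proof. by case: z => u v; rewrite /= mul0r subr0. Qed.

Lemma ReN (z : C) : complex.Re (- z) = - complex.Re z.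
Proof. by case: z. Qed.

Lemma quad_adj A x : quad (A^t* ) x = (quad A x)^*.
Proof. by rewrite /quad inner_adj trmxCK -innerC. Qed.

Lemma quadDm A B x : quad (A + B) x = quad A x + quad B x.
Proof. by rewrite /quad mulmxDl innerDl. Qed.

Lemma quadZm A c x : quad (c *: A) x = c * quad A x.
Proof. by rewrite /quad -scalemxAl innerZl. Qed.

(** With [M] the maximum of [Re (c <A y, y>)] on the sphere, the Hermitian
    matrix [2 M - (c A + (c A)^* )] is positive semidefinite, and its quadratic
    form vanishes at a maximiser. *)
Lemma maximizes_eigen A c x : inner x x = 1 -> maximizes A c x ->
  (c *: A + (c *: A)^t* ) *m x =
  (2 * complex.Re (c * quad A x))%:C *: x.
Proof.
move=> x1 cx; set M := complex.Re _.
pose N := (2 * M)%:C%:M - (c *: A + (c *: A)^t* ).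
have NE y : quad N y =
    2 * M%:C * inner y y - 2 * (complex.Re (c * quad A y))%:C.
  rewrite /N -scaleN1r quadDm quadZm mulN1r quadDm quad_adj !quadZm.
  rewrite (Re_adj (c * quad A y)).
  by rewrite {1}/quad mul_scalar_mx innerZl rmorphM rmorph_nat.
have hN : N^t* = N.
  have hS : (c *: A + (c *: A)^t* )^t* = c *: A + (c *: A)^t*.
    by rewrite [LHS]adjD trmxCK addrC.
  rewrite /N -scaleN1r [LHS]adjD (adjZ (-1)) hS rmorphN rmorph1; congr (_ + _).
  by rewrite tr_scalar_mx map_scalar_mx; congr _%:M; exact: conjc_real.
have psd y : 0 <= quad N y.
  rewrite NE -mulrA -mulrBr mulr_ge0 ?ler0n // subr_ge0.
  have [->|y0] := eqVneq y 0.
    by rewrite /quad !mulmx0 !inner0l !mulr0.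
  have [d d1 d2] := unit_multiple y0.
  have := cx _ d1; rewrite quadZ mulrCA d2 -/M -inner_real -fmorphV ReZ.
  by rewrite -rmorphM lecR ler_pdivrMl ?Re_inner_gt0 // [_ * M]mulrC.
have /(psd_isotropic_kernel hN psd)/eqP : quad N x = 0.
  by rewrite NE x1 mulr1 subrr.
by rewrite mulmxBl mul_scalar_mx subr_eq0 => /eqP ->.
Qed.

End BoundarySupport.

(** * Orthonormal bases over the boundary *)

Section BoundaryBasis.
Context {R : realType} {n : nat}.
Local Notation C := R[i].
Implicit Types (A U : 'M[C]_n.+1) (x : 'I_n.+1 -> 'cV[C]_n.+1).

Lemma inner_unitary U (y z : 'cV_n.+1) : U \is unitarymx ->
  inner (U *m y) (U *m z) = inner y z.
Proof.
by move=> uU; rewrite inner_adj mulmxA unitarymx_mulC // mul1mx.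
Qed.

Lemma quad_unitary A U y : quad (U^t* *m A *m U) y = quad A (U *m y).
Proof.
by rewrite /quad -[_ *m A *m U]mulmxA -mulmxA inner_adj trmxCK mulmxA.
Qed.

Lemma maximizes_unitary A U c y : U \is unitarymx ->
  maximizes A c (U *m y) -> maximizes (U^t* *m A *m U) c y.
Proof.
by move=> uU max z z1; rewrite !quad_unitary max // inner_unitary.
Qed.

Definition basis_mx x : 'M[C]_n.+1 := \matrix_(i, j) x j i 0.

Lemma basis_mxE x j : basis_mx x *m delta_mx j 0 = x j.
Proof. by rewrite -colE; apply/colP => i; rewrite !mxE. Qed.

Lemma basis_unitary x : Defs.orthonormal x -> basis_mx x \is unitarymx.
Proof.
move=> ox; apply/unitarymxP/mulmx1C/matrixP => i j.
rewrite [RHS]mxE eq_sym -ox innerE mxE.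
by apply: eq_bigr => k _; rewrite !mxE.
Qed.

Lemma inner_delta (i j : 'I_n.+1) :
  inner (delta_mx i 0 : 'cV[C]_n.+1) (delta_mx j 0) = (i == j)%:R.
Proof.
rewrite innerE (bigD1 j) //= big1 => [|k kj]; rewrite !mxE ?eqxx ?andbT.
  by rewrite rmorph1 mul1r addr0 eq_sym.
by rewrite (negbTE kj) rmorph0 mul0r.
Qed.

Lemma quad_delta A j : quad A (delta_mx j 0) = A j j.
Proof.
rewrite /quad innerE -colE (bigD1 j) //= big1 => [|i ij]; last first.
  by rewrite !mxE (negbTE ij) rmorph0 mul0r.
by rewrite !mxE !eqxx rmorph1 mul1r addr0.
Qed.

Lemma maximizes_delta A c j k : maximizes A c (delta_mx j 0) -> k != j ->
  c * A k j + (c * A j k)^* = 0.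
Proof.
move=> max kj.
have x1 : inner (delta_mx j 0 : 'cV[C]_n.+1) (delta_mx j 0) = 1.
  by rewrite inner_delta eqxx.
have := maximizes_eigen x1 max.
by rewrite -colE => /colP/(_ k); rewrite !mxE (negbTE kj) mulr0.
Qed.

(** In the basis [x] the maximality of [x j] in the direction
    [c j] reads [c_j a_kj = - conj (c_j a_jk)] for [k <> j]; eliminating
    [a_jk] between this and its mirror image gives [c_j^2 a_kj = c_k^2 a_kj].
    Hence [diag (c_j^2)] lies in the commutant, and irreducibility makes all
    [c_j] equal up to sign. *)
Lemma boundary_basis_direction A x : unitarily_irreducible A ->
  boundary_family A x ->
  exists theta, forall j,
    maximizes A (expi theta) (x j) \/ maximizes A (- expi theta) (x j).
Proof.
move=> irrA [ox bx].
have x1 j : inner (x j) (x j) = 1 by rewrite ox eqxx.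
have [theta max] := choice (fun j => boundary_support (x1 j) (bx j)).
pose c j := expi (theta j); pose X := basis_mx x.
have uX : X \is unitarymx := basis_unitary ox.
pose B := X^t* *m A *m X.
have irrB : unitarily_irreducible B.
  by apply: irreducible_similar irrA; exists X.
have maxB j : maximizes B (c j) (delta_mx j 0).
  by apply: maximizes_unitary => //; rewrite basis_mxE; exact: max.
clearbody B; have cc j : c j * (c j)^* = 1 := expi_mulC _.
have off j k : k != j -> (B j k)^* = - (c j ^+ 2 * B k j).
  move=> kj; have /(congr1 (fun z => c j * z)) := maximizes_delta (maxB j) kj.
  rewrite mulr0 mulrDr rmorphM mulrA -expr2 mulrA cc mul1r addrC => /eqP.
  by rewrite addr_eq0 => /eqP.
have off' j k : k != j -> (B j k)^* = - (c k ^+ 2 * B k j).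
  move=> kj; have jk : j != k by rewrite eq_sym.
  have := congr1 (fun z => c k ^+ 2 * z^*) (off _ _ jk).
  rewrite /= conjCK rmorphN rmorphM rmorphXn /= mulrN mulrA -exprMn cc expr1n.
  by rewrite mul1r => ->; rewrite opprK.
pose P : 'M[C]_n.+1 := diag_mx (\row_j c j ^+ 2).
have comm j k : c j ^+ 2 * B k j = c k ^+ 2 * B k j.
  have [->//|kj] := eqVneq k j.
  by apply: oppr_inj; rewrite -off // off'.
have /is_scalar_mxP[a Pa] : is_scalar_mx P.
  apply: irreducible_scalar irrB _ _; apply/matrixP => k j.
    by rewrite mul_mx_diag mul_diag_mx !mxE mulrC comm.
  rewrite mul_mx_diag mul_diag_mx !mxE.
  have [->|jk] := eqVneq k j; first exact: mulrC.
  by rewrite off' // mulNr mulrN -mulrA [B k j * _]mulrC comm.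
have ca j : c j ^+ 2 = a by have /matrixP/(_ j j) := Pa; rewrite !mxE eqxx.
exists (theta 0) => j; have := max j; rewrite -/(c j) -/(c 0).
have /eqP := etrans (ca j) (esym (ca 0)).
by rewrite eqf_sqr => /orP[] /eqP ->; [left | right].
Qed.

(** Extremal vectors for one direction are eigenvectors of one Hermitian
    part, which is therefore diagonal in a basis of such vectors. *)
Lemma extremal_basis_diagonal A x theta : Defs.orthonormal x ->
  (forall j, maximizes A (expi theta) (x j) \/
             maximizes A (- expi theta) (x j)) ->
  exists H K : 'M[C]_n.+1,
    [/\ unitarily_similar (expi theta *: A) (H + 'i%C *: K),
        H \is hermsymmx, K \is hermsymmx &
        H = diag_mx (\row_j (complex.Re (expi theta * quad A (x j)))%:C)].
Proof.
move=> ox ext; have x1 j : inner (x j) (x j) = 1 by rewrite ox eqxx.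
pose X := basis_mx x; have uX : X \is unitarymx := basis_unitary ox.
pose A' := expi theta *: A; pose B := X^t* *m A' *m X.
have eig j : (A' + A'^t* ) *m x j =
    (2 * complex.Re (expi theta * quad A (x j)))%:C *: x j.
  case: (ext j) => /(maximizes_eigen (x1 j)) //.
  rewrite scaleNr -/A' -scaleN1r adjZ rmorphN rmorph1 -scalerDr scaleN1r.
  rewrite mulNmx mulNr raddfN mulrN rmorphN scaleNr => /oppr_inj //.
have two : 2 != 0 :> C by rewrite pnatr_eq0.
have i0 : 'i%C != 0 :> C by rewrite complexiE neq0Ci.
have iJ : ('i%C : C)^* = - 'i%C by rewrite complexiE conjCi.
have twoJ : (2^-1 : C)^* = 2^-1 by rewrite fmorphV rmorph_nat.
pose H := 2^-1 *: (B + B^t* ); pose K := (2 * 'i%C)^-1 *: (B - B^t* ).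
exists H, K; split.
- exists X => //; rewrite -/A' -/B /H /K scalerA.
  have -> : 'i%C * (2 * 'i%C)^-1 = 2^-1 :> C by field; rewrite i0.
  rewrite -scalerDr addrACA subrr addr0 -mulr2n -[B *+ 2]scaler_nat scalerA.
  by rewrite mulVf // scale1r.
- by rewrite hermE /H adjZ adjD trmxCK twoJ [B^t* + _]addrC.
- have J : ((2 * 'i%C)^-1 : C)^* = - (2 * 'i%C)^-1.
    by rewrite fmorphV rmorphM /= iJ rmorph_nat mulrN invrN.
  have BJ : (B - B^t* )^t* = - (B - B^t* ).
    rewrite -[in LHS]scaleN1r [LHS]adjD (adjZ (-1)) trmxCK rmorphN rmorph1.
    by rewrite scaleN1r opprB addrC.
  by rewrite hermE /K (adjZ _ (B - _)) BJ J scalerN scaleNr opprK.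
have HE : H = X^t* *m (2^-1 *: (A' + A'^t* )) *m X.
  rewrite /H /B !adjM trmxCK mulmxA -mulmxDl -mulmxDr.
  by rewrite -scalemxAr -scalemxAl.
apply/matrixP => k j.
have -> : H k j = (H *m delta_mx j (0 : 'I_1)) k 0 by rewrite -colE [RHS]mxE.
rewrite HE -(mulmxA _ X) basis_mxE -mulmxA -scalemxAl eig scalerA rmorphM.
rewrite rmorph_nat mulKf // -scalemxAr; have xj := basis_mxE x j.
rewrite -[in X in _ *: X]xj mulmxA unitarymx_mulC // mul1mx !mxE eqxx andbT.
by case: eqVneq => [->|_]; rewrite ?mulr1 ?mulr0.
Qed.

End BoundaryBasis.

(** * Two-by-two and four-by-four matrices *)

Section SmallMatrices.

(** Closed ordinals, at which the entries of [mx_of_rows] compute. *)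
Definition o2_0 : 'I_2 := @Ordinal 2 0 isT.
Definition o2_1 : 'I_2 := @Ordinal 2 1 isT.
Definition o4_0 : 'I_4 := @Ordinal 4 0 isT.
Definition o4_1 : 'I_4 := @Ordinal 4 1 isT.
Definition o4_2 : 'I_4 := @Ordinal 4 2 isT.
Definition o4_3 : 'I_4 := @Ordinal 4 3 isT.

Lemma sum2 (V : nmodType) (F : 'I_2 -> V) : \sum_i F i = F o2_0 + F o2_1.
Proof. by rewrite big_ord_recl big_ord1; congr (F _ + F _); apply/val_inj. Qed.

Lemma sum4 (V : nmodType) (F : 'I_4 -> V) :
  \sum_i F i = F o4_0 + F o4_1 + F o4_2 + F o4_3.
Proof.
rewrite !big_ord_recl big_ord0 addr0 !addrA.
by congr (F _ + F _ + F _ + F _); apply/val_inj.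
Qed.

Lemma forall2P (Q : 'I_2 -> Prop) : Q o2_0 -> Q o2_1 -> forall i, Q i.
Proof.
move=> q0 q1 [[|[|//]] h].
- by have -> : Ordinal h = o2_0 by apply/val_inj.
- by have -> : Ordinal h = o2_1 by apply/val_inj.
Qed.

Lemma forall4P (Q : 'I_4 -> Prop) :
  Q o4_0 -> Q o4_1 -> Q o4_2 -> Q o4_3 -> forall i, Q i.
Proof.
move=> q0 q1 q2 q3 [[|[|[|[|//]]]] h].
- by have -> : Ordinal h = o4_0 by apply/val_inj.
- by have -> : Ordinal h = o4_1 by apply/val_inj.
- by have -> : Ordinal h = o4_2 by apply/val_inj.
- by have -> : Ordinal h = o4_3 by apply/val_inj.
Qed.

Definition mx2 (T : nmodType) (a b c d : T) : 'M[T]_2 :=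
  mx_of_rows 2 2 [:: [:: a; b]; [:: c; d]].

Definition diag4 (T : nmodType) (a b c d : T) : 'M[T]_4 :=
  mx_of_rows 4 4 [:: [:: a; 0; 0; 0]; [:: 0; b; 0; 0];
                     [:: 0; 0; c; 0]; [:: 0; 0; 0; d]].

Lemma mx2E (T : nmodType) (A : 'M[T]_2) :
  A = mx2 (A o2_0 o2_0) (A o2_0 o2_1) (A o2_1 o2_0) (A o2_1 o2_1).
Proof. by apply/matrixP; do 2![apply: forall2P]; rewrite mxE. Qed.

Lemma block2_mx (T : nmodType) (a b c d a' b' c' d' e f g h e' f' g' h' : T) :
  block_mx (mx2 a b c d) (mx2 e f g h) (mx2 e' f' g' h') (mx2 a' b' c' d')
  = mx_of_rows 4 4 [:: [:: a; b; e; f]; [:: c; d; g; h];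
                       [:: e'; f'; a'; b']; [:: g'; h'; c'; d']]
  :> 'M[T]_(2 + 2).
Proof.
apply/matrixP; do 2![apply: (@forall4P)]; rewrite !mxE /=;
  case: splitP => -[[|[|//]] i] //= _; rewrite !mxE /=;
  by case: splitP => -[[|[|//]] j] //= _; rewrite !mxE.
Qed.

Lemma diag4E (T : nmodType) (d : 'I_4 -> T) :
  diag_mx (\row_i d i) = diag4 (d o4_0) (d o4_1) (d o4_2) (d o4_3).
Proof. by apply/matrixP; do 2![apply: forall4P]; rewrite !mxE. Qed.

Lemma diag4_seq (T : nmodType) (a b c d : T) :
  diag4 a b c d = diag_mx (\row_i nth 0 [:: a; b; c; d] i).
Proof. by rewrite diag4E. Qed.

End SmallMatrices.

(* The [(i, j)] entry of an equation [e] between products with an explicit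
   four-by-four matrix. *)
Local Ltac entry e i j := have := e i j; rewrite !mxE !sum4 !mxE /=.

Section SVD2.
Context {R : realType}.
Local Notation C := R[i].

Lemma phase (z : C) : exists2 w : C, w * w^* = 1 & w^* * z = `|z|.
Proof.
have [->|z0] := eqVneq z 0.
  by exists 1; rewrite ?mulr0 ?normr0 ?rmorph1 ?mulr1.
have n0 : `|z| != 0 by rewrite normr_eq0.
have nJ : `|z|^* = `|z| by apply/CrealP/normr_real.
exists (z / `|z|); rewrite rmorphM fmorphV /= nJ.
  by rewrite mulrACA -normCK -invfM -expr2 divff // expf_neq0.
by rewrite mulrAC [z^* * z]mulrC -normCK expr2 mulfK.
Qed.

Lemma mul_mx2 (a b c d a' b' c' d' : C) : mx2 a b c d *m mx2 a' b' c' d' =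
  mx2 (a * a' + b * c') (a * b' + b * d') (c * a' + d * c') (c * b' + d * d').
Proof. by apply/matrixP; do 2![apply: forall2P]; rewrite !mxE sum2 !mxE. Qed.

Lemma adj_mx2 (a b c d : C) : (mx2 a b c d)^t* = mx2 a^* c^* b^* d^*.
Proof. by apply/matrixP; do 2![apply: forall2P]; rewrite !mxE. Qed.

Lemma scalar_mx2 (a : C) : a%:M = mx2 a 0 0 a.
Proof. by apply/matrixP; do 2![apply: forall2P]; rewrite !mxE. Qed.

(** The phase [w] is the freedom left in the second vector of an orthonormal
    basis of the plane that starts with [(a, b)]. *)
Definition unit_frame (a b w : C) : 'M[C]_2 := mx2 a (- (w * b^*)) b (w * a^*).

Lemma unit_frame_unitary a b w : a^* * a + b^* * b = 1 -> w * w^* = 1 ->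
  unit_frame a b w \is unitarymx.
Proof.
move=> ab ww; apply/unitarymxP/mulmx1C; rewrite adj_mx2 mul_mx2 scalar_mx2.
rewrite rmorphN !rmorphM /= !conjCK; congr mx2; first exact: ab.
- by ring.
- by ring.
transitivity ((w * w^*) * (a^* * a + b^* * b)); first by ring.
by rewrite ww ab mulr1.
Qed.

Lemma swap_unitary : mx2 0 1 1 0 \is @unitarymx C 2 2.
Proof.
apply/unitarymxP; rewrite adj_mx2 mul_mx2 scalar_mx2 !rmorph0 !rmorph1.
by rewrite !mul0r !mul1r !addr0 !add0r.
Qed.

(** The frame starts along the first column, so that the second column is a
    multiple of its second vector; the free phase makes the multiple
    nonnegative. *)
Lemma diagonalize_orthogonal_columns (p q r s : C) :
  p^* * q + r^* * s = 0 -> (p != 0) || (r != 0) ->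
  exists2 U : 'M[C]_2, U \is unitarymx & exists s1 s2 : R,
    [/\ 0 <= s1, 0 <= s2 & U^t* *m mx2 p q r s = mx2 s1%:C 0 0 s2%:C].
Proof.
move=> ort pr; pose N := `|p| ^+ 2 + `|r| ^+ 2.
have N0 : 0 < N.
  by rewrite lt0r addr_ge0 ?exprn_ge0 // andbT paddr_eq0 ?exprn_ge0 //
     !expf_eq0 !normr_eq0 /= negb_and.
pose t := sqrtC N; have t0 : 0 < t by rewrite sqrtC_gt0.
have t2 : t * t = N by rewrite -expr2 sqrtCK.
have tN : t != 0 by rewrite gt_eqF.
have tJ : t^* = t by apply/CrealP/gtr0_real.
have NE : p^* * p + r^* * r = t * t by rewrite t2 /N !normCKC.
pose a := p / t; pose b := r / t.
have [w ww wz] := phase (a * s - b * q).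
exists (unit_frame a b w).
  apply: unit_frame_unitary => //; rewrite /a /b !rmorphM !fmorphV /= tJ.
  transitivity ((p^* * p + r^* * r) / (t * t)); first by field.
  by rewrite NE divff // mulf_neq0.
exists (complex.Re t), (complex.Re `|a * s - b * q|).
have -> : (complex.Re t)%:C = t by rewrite RRe_real // gtr0_real.
have -> : (complex.Re `|a * s - b * q|)%:C = `|a * s - b * q|.
  by rewrite RRe_real // normr_real.
rewrite -!lecR !RRe_real ?(gtr0_real t0) ?normr_real //; split;
  rewrite ?normr_ge0 ?(ltW t0) //.
have aJ : a^* = p^* / t by rewrite /a rmorphM fmorphV /= tJ.
have bJ : b^* = r^* / t by rewrite /b rmorphM fmorphV /= tJ.
have [aE bE] : a = p / t /\ b = r / t by [].
clearbody a b; rewrite adj_mx2 mul_mx2 rmorphN !rmorphM /= !conjCK aJ bJ.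
congr mx2.
- transitivity ((p^* * p + r^* * r) / t); first by field.
  by rewrite NE mulfK.
- transitivity ((p^* * q + r^* * s) / t); first by field.
  by rewrite ort mul0r.
- by rewrite aE bE; ring.
- by rewrite -wz aE bE; ring.
Qed.

(** The columns of [M V] are orthogonal when [V] diagonalises [M^* M]. *)
Lemma orthogonal_columns (M : 'M[C]_2) : exists2 V : 'M[C]_2, V \is unitarymx &
  exists p q r s : C, M *m V = mx2 p q r s /\ p^* * q + r^* * s = 0.
Proof.
pose G := M^t* *m M; have hG : G \is hermsymmx.
  by rewrite hermE /G adjM trmxCK.
have uP := spectral_unitarymx G; set P := spectralmx G in uP.
have GE := orthomx_spectralP (hermitian_normalmx hG); rewrite -/P in GE.
exists (P^t* ); first by rewrite trmxC_unitary.
set N := M *m _.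
exists (N o2_0 o2_0), (N o2_0 o2_1), (N o2_1 o2_0), (N o2_1 o2_1).
split; first exact: mx2E.
have NN : N^t* *m N = diag_mx (spectral_diag G).
  rewrite /N adjM trmxCK mulmxA -(mulmxA P) -/G.
  rewrite [X in P *m X *m _]GE invmx_unitary //.
  by rewrite !mulmxA (unitarymxP uP) mul1mx -mulmxA (unitarymxP uP) mulmx1.
have := congr1 (fun X : 'M[C]_2 => X o2_0 o2_1) NN.
by rewrite [LHS]mxE sum2 [RHS]mxE /= mulr0n ![(N^t* ) _ _]mxE ![N^T _ _]mxE.
Qed.

(** Singular value decomposition, by [diagonalize_orthogonal_columns] after
    exchanging columns if the first one vanishes, and both singular values if
    they come out in the wrong order. *)
Lemma svd2 (M : 'M[C]_2) : exists U V : 'M[C]_2,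
  [/\ U \is unitarymx, V \is unitarymx & exists s1 s2 : R,
    [/\ 0 <= s2, s2 <= s1 & U^t* *m M *m V = mx2 s1%:C 0 0 s2%:C]].
Proof.
have swap (a b c d : C) : mx2 a b c d *m mx2 0 1 1 0 = mx2 b a d c.
  by rewrite mul_mx2 !mulr0 !mulr1 !addr0 !add0r.
have [V uV [p [q [r [s [MV ort]]]]]] := orthogonal_columns M.
have uS := swap_unitary.
suff [U [W [uU uW [s1 [s2 [s10 s20 E]]]]]] : exists U W : 'M[C]_2,
    [/\ U \is unitarymx, W \is unitarymx & exists s1 s2 : R,
    [/\ 0 <= s1, 0 <= s2 & U^t* *m M *m W = mx2 s1%:C 0 0 s2%:C]].
  have [s12|s12] := leP s2 s1; first by exists U, W; split=> //; exists s1, s2.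
  exists (U *m mx2 0 1 1 0), (W *m mx2 0 1 1 0).
  have uUS : U *m mx2 0 1 1 0 \is unitarymx := mul_unitarymx uU uS.
  have uWS : W *m mx2 0 1 1 0 \is unitarymx := mul_unitarymx uW uS.
  split; [exact: uUS | exact: uWS | exists s2, s1].
  rewrite (ltW s12) s10.
  split=> //.
  transitivity ((mx2 0 1 1 0)^t* *m (U^t* *m M *m W) *m mx2 0 1 1 0).
    by rewrite (adjM U) !mulmxA.
  rewrite E -mulmxA swap adj_mx2 !rmorph0 !rmorph1 mul_mx2.
  by rewrite !mul0r !mul1r !addr0 !add0r.
have [pr|] := boolP ((p != 0) || (r != 0)).
  have [U uU [s1 [s2 [s10 s20 E]]]] := diagonalize_orthogonal_columns ort pr.
  by exists U, V; split=> //; exists s1, s2; rewrite -mulmxA MV.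
rewrite negb_or !negbK => /andP[/eqP p0 /eqP r0].
have [qs|] := boolP ((q != 0) || (s != 0)).
  have ort' : q^* * p + s^* * r = 0 by rewrite p0 r0 !mulr0 addr0.
  have [U uU [s1 [s2 [s10 s20 E]]]] := diagonalize_orthogonal_columns ort' qs.
  exists U, (V *m mx2 0 1 1 0).
  have uVS : V *m mx2 0 1 1 0 \is unitarymx := mul_unitarymx uV uS.
  split; [exact: uU | exact: uVS | exists s1, s2].
  by rewrite -mulmxA (mulmxA M) MV swap.
rewrite negb_or !negbK => /andP[/eqP q0 /eqP s0].
have u1 : (1%:M : 'M[C]_2) \is unitarymx.
  by apply/unitarymxP; rewrite trmx1 map_mx1 mulmx1.
exists 1%:M, V; split=> //; exists 0, 0; split=> //.
by rewrite -mulmxA MV p0 q0 r0 s0 trmx1 map_mx1 mul1mx.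
Qed.

End SVD2.

(** * The commutant of the form with eigenspaces of dimensions two and two *)

Section FormA.
Context {R : realType}.
Local Notation C := R[i].

Definition formA (k11 k22 k33 k44 k12 k34 : C) (s1 s2 : R) : 'M[C]_4 :=
  mx_of_rows 4 4 [:: [:: k11; k12; s1%:C; 0]; [:: k12^*; k22; 0; s2%:C];
                     [:: s1%:C; 0; k33; k34]; [:: 0; s2%:C; k34^*; k44]].

Lemma eq_realC (a b : R) : (a%:C == b%:C :> C) = (a == b).
Proof. exact: inj_eq (@complexI R) _ _. Qed.

Lemma parallel_trans1 (p q r u v w x y z : C) : p != 0 ->
  p * v = q * u -> p * w = r * u -> p * y = q * x -> p * z = r * x ->
  [/\ u * y = v * x, u * z = w * x & v * z = w * y].
Proof.
move=> p0 e1 e2 f1 f2; split; apply: (mulfI p0).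
- by rewrite mulrCA f1 [RHS]mulrA e1; ring.
- by rewrite mulrCA f2 [RHS]mulrA e2; ring.
apply: (mulfI p0); transitivity ((p * v) * (p * z)); first by ring.
rewrite e1 f2; transitivity ((p * w) * (p * y)); last by ring.
by rewrite e2 f1; ring.
Qed.

(** Vectors of C^3 parallel to a common nonzero vector are parallel.  By
    [commute_mx2] this makes commuting with a non-scalar two-by-two matrix
    transitive. *)
Lemma parallel_trans (p q r u v w x y z : C) :
  ~ (p = 0 /\ q = 0 /\ r = 0) ->
  p * v = q * u -> p * w = r * u -> q * w = r * v ->
  p * y = q * x -> p * z = r * x -> q * z = r * y ->
  [/\ u * y = v * x, u * z = w * x & v * z = w * y].
Proof.
move=> nz e1 e2 e3 f1 f2 f3.
have [p0|p0] := eqVneq p 0; last exact: (parallel_trans1 p0 e1 e2 f1 f2).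
have [q0|q0] := eqVneq q 0; last first.
  by have [? ? ?] := parallel_trans1 q0 (esym e1) e3 (esym f1) f3; split.
have [r0|r0] := eqVneq r 0; first by case: nz.
have [? ? ?] :=
  parallel_trans1 r0 (esym e2) (esym e3) (esym f2) (esym f3).
by split.
Qed.

Lemma eq_of_diff (x y l r : C) : l = r -> x - y = l - r -> x = y.
Proof. by move=> -> /eqP; rewrite subrr subr_eq0 => /eqP. Qed.

(** Two-by-two matrices commute exactly when their triples (difference of the
    diagonal entries, off-diagonal entries) are parallel. *)
Lemma commute_mx2 (a b c d a' b' c' d' : C) :
  (a - d) * b' = b * (a' - d') -> (a - d) * c' = c * (a' - d') ->
  b * c' = c * b' -> comm_mx (mx2 a b c d) (mx2 a' b' c' d').
Proof.
move=> e1 e2 e3; rewrite /comm_mx !mul_mx2; congr mx2.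
- by rewrite [X in _ + X]e3; ring.
- apply/eqP; rewrite -subr_eq0; apply/eqP.
  transitivity ((a - d) * b' - b * (a' - d')); first by ring.
  by rewrite e1 subrr.
- apply/eqP; rewrite -subr_eq0; apply/eqP.
  transitivity (- ((a - d) * c' - c * (a' - d'))); first by ring.
  by rewrite e2 subrr oppr0.
- by rewrite -e3; ring.
Qed.

(** Commuting with [H] makes [P] block diagonal, with blocks [P1] and [P2];
    commuting with [K] then means that [P1] commutes with [K1], [P2] with [K2],
    and [P1 Sigma = Sigma P2], [P2 Sigma = Sigma P1].  If [s1 = s2] this forces
    [P1 = P2]; otherwise [P1] and [P2] commute with [Sigma^2], so that both are
    diagonal. *)
Lemma formA_commutant (h1 h2 : R) k11 k22 k33 k44 k12 k34 s1 s2 :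
  h1 != h2 -> 0 < s1 -> s2 <= s1 -> 0 <= s2 ->
  (s2 = 0 -> k12 * k34 != 0) ->
  (s1 = s2 -> ~ comm_mx (mx2 k11 k12 k12^* k22) (mx2 k33 k34 k34^* k44)) ->
  (s2 < s1 -> 0 < s2 -> k12 != 0 \/ k34 != 0) ->
  trivial_commutant (diag4 h1%:C h1%:C h2%:C h2%:C)
    (formA k11 k22 k33 k44 k12 k34 s1 s2).
Proof.
move=> h12 s10 s21 s20 c0 c1 c2 P /matrixP eH /matrixP eK.
have s1N : s1%:C != 0 :> C by rewrite eq_realC gt_eqF.
have hC : h1%:C != h2%:C :> C by rewrite eq_realC.
have hC' : h2%:C != h1%:C :> C by rewrite eq_sym.
have off (i j : 'I_4) (h := nth 0 [:: h1%:C; h1%:C; h2%:C; h2%:C]) :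
    h i != h j -> P i j = 0.
  move: eH => /matrixP; rewrite diag4_seq => /commute_diag_zero eH hij.
  by apply: eH; rewrite !mxE.
have z02 : P o4_0 o4_2 = 0 := off o4_0 o4_2 hC.
have z03 : P o4_0 o4_3 = 0 := off o4_0 o4_3 hC.
have z12 : P o4_1 o4_2 = 0 := off o4_1 o4_2 hC.
have z13 : P o4_1 o4_3 = 0 := off o4_1 o4_3 hC.
have z20 : P o4_2 o4_0 = 0 := off o4_2 o4_0 hC'.
have z21 : P o4_2 o4_1 = 0 := off o4_2 o4_1 hC'.
have z30 : P o4_3 o4_0 = 0 := off o4_3 o4_0 hC'.
have z31 : P o4_3 o4_1 = 0 := off o4_3 o4_1 hC'.
pose Z := (z02, z03, z12, z13, z20, z21, z30, z31, mul0r, mulr0, addr0, add0r).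
entry eK o4_0 o4_2; rewrite !Z => e02.
entry eK o4_0 o4_3; rewrite !Z => e03.
entry eK o4_1 o4_2; rewrite !Z => e12.
entry eK o4_1 o4_3; rewrite !Z => e13.
entry eK o4_2 o4_1; rewrite !Z => e21.
entry eK o4_3 o4_0; rewrite !Z => e30.
entry eK o4_0 o4_0; rewrite !Z => e00.
entry eK o4_0 o4_1; rewrite !Z => e01.
entry eK o4_1 o4_0; rewrite !Z => e10.
entry eK o4_2 o4_2; rewrite !Z => e22.
entry eK o4_2 o4_3; rewrite !Z => e23.
entry eK o4_3 o4_2; rewrite !Z => e32.
have E22 : P o4_2 o4_2 = P o4_0 o4_0 by apply: (mulfI s1N); rewrite e02 mulrC.
suff [E11 E33 E01 E10 [E23 E32]] : [/\ P o4_1 o4_1 = P o4_0 o4_0,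
    P o4_3 o4_3 = P o4_0 o4_0, P o4_0 o4_1 = 0, P o4_1 o4_0 = 0 &
    P o4_2 o4_3 = 0 /\ P o4_3 o4_2 = 0].
  apply/is_scalar_mxP; exists (P o4_0 o4_0); apply/matrixP.
  by do 2![apply: forall4P]; rewrite mxE /=.
move: e00 e01 e10 e22 e23 e32 e03 e12 e13 e21 e30.
rewrite E22; move: (P o4_0 o4_0) (P o4_0 o4_1) (P o4_1 o4_0) (P o4_1 o4_1)
  (P o4_2 o4_3) (P o4_3 o4_2) (P o4_3 o4_3) => a b c d f g h.
move=> e00 e01 e10 e22 e23 e32 e03 e12 e13 e21 e30.
have cancel z w u : z != 0 -> u = 0 -> z * w = u -> w = 0 :> C.
  by move=> z0 -> /eqP; rewrite mulf_eq0 (negbTE z0) => /eqP.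
have [s20'|s2N] := eqVneq s2 0.
  have := c0 s20'; rewrite mulf_eq0 negb_or => /andP[k12N k34N].
  move: e03 e12 e13 e21 e30; rewrite s20' ?(mulr0, mul0r) => e03 e12 _ e21 e30.
  have f0 : f = 0 by exact: cancel s1N _ e03.
  have c00 : c = 0 by apply: (cancel _ _ _ s1N (erefl 0)); rewrite mulrC.
  have b0 : b = 0 by exact: (cancel _ _ _ s1N (erefl 0)).
  have g0 : g = 0 by apply: (cancel _ _ _ s1N (erefl 0)); rewrite mulrC.
  move: e01 e23; rewrite b0 f0 ?(mulr0, mul0r, addr0, add0r).
  move=> e01 e23; have -> : d = a by apply: (mulfI k12N); rewrite e01 mulrC.
  by have -> : h = a by apply: (mulfI k34N); rewrite e23 mulrC.
have s2P : 0 < s2 by rewrite lt0r s2N.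
have s2C : s2%:C != 0 :> C by rewrite eq_realC.
have E33 : h = d by apply: (mulfI s2C); rewrite e13 mulrC.
rewrite E33 in e23 e32 e22 *.
have [s12|s12] := eqVneq s1 s2.
  move: e03 e12 e21 e30; rewrite -s12 => e03 e12 e21 e30.
  have fb : f = b by apply: (mulfI s1N); rewrite e03 mulrC.
  have gc : g = c by apply: (mulfI s1N); rewrite e12 mulrC.
  rewrite fb gc in e22 e23 e32 *.
  have [[ad [b0 c0']]|nz] := pselect (a - d = 0 /\ b = 0 /\ c = 0).
    by move/eqP: ad; rewrite subr_eq0 => /eqP ->.
  case: (c1 s12); have [||||||? ? ?] := @parallel_trans (a - d) b c
    (k11 - k22) k12 k12^* (k33 - k44) k34 k34^* nz.
  - by apply: eq_of_diff (esym e01) _; ring.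
  - by apply: eq_of_diff e10 _; ring.
  - by apply: eq_of_diff (esym e00) _; ring.
  - by apply: eq_of_diff (esym e23) _; ring.
  - by apply: eq_of_diff e32 _; ring.
  - by apply: eq_of_diff (esym e22) _; ring.
  exact: commute_mx2.
(* For [s2 < s1] the equations [e03] and [e21] give [(s1^2 - s2^2) b = 0]. *)
have s12' : s2 < s1 by rewrite lt_neqAle eq_sym s12 s21.
have sq : s1%:C * s1%:C - s2%:C * s2%:C != 0 :> C.
  by rewrite -!expr2 -!rmorphXn -rmorphB /= eq_realC subr_eq0 gt_eqF //
     ltr_pXn2r // nnegrE ?ltW.
have b0 : b = 0.
  apply: (cancel _ _ _ sq (erefl 0)); rewrite mulrBl -!mulrA e21.
  by rewrite [f * _]mulrC [s1%:C * (_ * f)]mulrCA e03 [b * _]mulrC subrr.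
have c00 : c = 0.
  apply: (cancel _ _ _ sq (erefl 0)); rewrite mulrBl -!mulrA e30.
  by rewrite [g * _]mulrC [s2%:C * (_ * g)]mulrCA e12 [c * _]mulrC subrr.
have f0 : f = 0 by apply: cancel s1N _ e03; rewrite b0 mul0r.
have g0 : g = 0 by apply: cancel s2C _ e12; rewrite c00 mul0r.
suff -> : d = a by [].
case: (c2 s12' s2P) => kN; apply: (mulfI kN).
  by move: e01; rewrite b0 ?(mulr0, mul0r, addr0, add0r) [a * _]mulrC.
by move: e23; rewrite f0 ?(mulr0, mul0r, addr0, add0r) [a * _]mulrC.
Qed.

Lemma scalar_mx_off (P : 'M[C]_4) i j : is_scalar_mx P -> i != j -> P i j = 0.
Proof. by move=> /is_scalar_mxP[a ->] /negbTE ij; rewrite mxE ij. Qed.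

Lemma scalar_mx4_block (a b : C) :
  diag4 a a b b = block_mx a%:M 0 0 b%:M :> 'M[C]_(2 + 2).
Proof.
have z : 0 = mx2 0 0 0 0 :> 'M[C]_2.
  by apply/matrixP; do 2![apply: forall2P]; rewrite !mxE.
by rewrite !scalar_mx2 z block2_mx.
Qed.

(** Each degenerate case leaves a set of coordinates that [K] does not link to
    the others, except commuting blocks with [s1 = s2]: then [diag (X, X)] is
    in the commutant for every [X] that commutes with both blocks. *)
Lemma formA_conditions (h1 h2 : R) k11 k22 k33 k44 k12 k34 s1 s2 :
  s2 <= s1 -> 0 <= s2 ->
  trivial_commutant (diag4 h1%:C h1%:C h2%:C h2%:C)
    (formA k11 k22 k33 k44 k12 k34 s1 s2) ->
  [/\ 0 < s1, s2 = 0 -> k12 * k34 != 0,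
    s1 = s2 -> ~ comm_mx (mx2 k11 k12 k12^* k22) (mx2 k33 k34 k34^* k44) &
    s2 < s1 -> 0 < s2 -> k12 != 0 \/ k34 != 0].
Proof.
move=> s21 s20 triv.
have conn (S : pred 'I_4) :
    (forall i j, formA k11 k22 k33 k44 k12 k34 s1 s2 i j != 0 ->
      S i = S j) -> forall i j, S i = S j.
  by move: triv; rewrite diag4_seq; exact: trivial_commutant_connected.
split.
- rewrite lt0r (le_trans s20 s21) andbT; apply/eqP => s10.
  have s20' : s2 = 0 by apply/eqP; rewrite eq_le s20 -s10 s21.
  suff /(_ o4_0 o4_2) : forall i j : 'I_4, (i < 2)%N = (j < 2)%N by [].
  by apply: conn; do 2![apply: forall4P]; rewrite mxE /= ?s10 ?s20' ?eqxx.
- move=> s20'; rewrite mulf_eq0; apply/negP => /orP[/eqP k0|/eqP k0].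
    suff /(_ o4_0 o4_1) : forall i j : 'I_4, (i == o4_1) = (j == o4_1) by [].
    apply: conn; do 2![apply: forall4P];
      by rewrite mxE /= ?s20' ?k0 ?rmorph0 ?eqxx.
  suff /(_ o4_0 o4_3) : forall i j : 'I_4, (i == o4_3) = (j == o4_3) by [].
  apply: conn; do 2![apply: forall4P];
    by rewrite mxE /= ?s20' ?k0 ?rmorph0 ?eqxx.
- move=> s12 com.
  have FE : formA k11 k22 k33 k44 k12 k34 s1 s2 =
      block_mx (mx2 k11 k12 k12^* k22) s1%:C%:M s1%:C%:M (mx2 k33 k34 k34^* k44)
      :> 'M[C]_(2 + 2).
    by rewrite scalar_mx2 block2_mx -s12.
  move: triv com; rewrite FE scalar_mx4_block.
  set K1 := mx2 k11 _ _ _; set K2 := mx2 k33 _ _ _ => triv com.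
  (* Applied to [X = K1] and [X = K2]: both blocks are then diagonal, and
     the coordinates of even and of odd index are not linked. *)
  have sc X : comm_mx K1 X -> comm_mx K2 X ->
      is_scalar_mx (block_mx X 0 0 X : 'M[C]_(2 + 2)).
    move=> XK1 XK2; apply: triv.
      rewrite !(@mulmx_block _ 2 2 2 2 2 2) !mulmx0 !mul0mx !addr0 !add0r.
      by rewrite !mul_scalar_mx !mul_mx_scalar.
    rewrite !(@mulmx_block _ 2 2 2 2 2 2) !mulmx0 !mul0mx !addr0 !add0r.
    by rewrite XK1 XK2 !mul_scalar_mx !mul_mx_scalar.
  have := sc _ (erefl _) (esym com); have := sc _ com (erefl _).
  rewrite /K1 /K2.
  have z : 0 = mx2 0 0 0 0 :> 'M[C]_2.
    by apply/matrixP; do 2![apply: forall2P]; rewrite !mxE.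
  rewrite z !block2_mx => sc2 sc1.
  have := scalar_mx_off (i := o4_0) (j := o4_1) sc1 isT.
  have := scalar_mx_off (i := o4_0) (j := o4_1) sc2 isT.
  rewrite !mxE /= => k340 k120.
  suff /(_ o4_0 o4_1) : forall i j : 'I_4, odd i = odd j by [].
  apply: conn; do 2![apply: forall4P];
    by rewrite mxE /= ?k340 ?k120 ?rmorph0 ?eqxx.
move=> s12 s20'; apply: contrapT.
move=> /not_orP[/negP/negPn/eqP k120 /negP/negPn/eqP k340].
suff /(_ o4_0 o4_1) : forall i j : 'I_4, odd i = odd j by [].
apply: conn; do 2![apply: forall4P];
  by rewrite mxE /= ?k340 ?k120 ?rmorph0 ?eqxx.
Qed.

End FormA.

(** * The commutant of the form with eigenspaces of dimensions three and one *)

Section FormB.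
Context {R : realType}.
Local Notation C := R[i].

Definition formB (k1 k2 k3 k4 b1 b2 b3 : R) : 'M[C]_4 :=
  mx_of_rows 4 4 [:: [:: k1%:C; 0; 0; b1%:C]; [:: 0; k2%:C; 0; b2%:C];
                     [:: 0; 0; k3%:C; b3%:C]; [:: b1%:C; b2%:C; b3%:C; k4%:C]].

Lemma formB_commutant (h1 h2 k1 k2 k3 k4 b1 b2 b3 : R) : h1 != h2 ->
  [/\ k1 != k2, k1 != k3 & k2 != k3] -> [/\ b1 != 0, b2 != 0 & b3 != 0] ->
  trivial_commutant (diag4 h1%:C h1%:C h1%:C h2%:C)
    (formB k1 k2 k3 k4 b1 b2 b3).
Proof.
move=> h12 [k12 k13 k23] [b1N b2N b3N] P /matrixP eH /matrixP eK.
have hC : h1%:C != h2%:C :> C by rewrite eq_realC.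
have hC' : h2%:C != h1%:C :> C by rewrite eq_sym.
pose S0 := (mul0r, mulr0, addr0, add0r).
have off (i j : 'I_4) (h := nth 0 [:: h1%:C; h1%:C; h1%:C; h2%:C]) :
    h i != h j -> P i j = 0.
  move: eH => /matrixP; rewrite diag4_seq => /commute_diag_zero eH hij.
  by apply: eH; rewrite !mxE.
have z03 : P o4_0 o4_3 = 0 := off o4_0 o4_3 hC.
have z13 : P o4_1 o4_3 = 0 := off o4_1 o4_3 hC.
have z23 : P o4_2 o4_3 = 0 := off o4_2 o4_3 hC.
have z30 : P o4_3 o4_0 = 0 := off o4_3 o4_0 hC'.
have z31 : P o4_3 o4_1 = 0 := off o4_3 o4_1 hC'.
have z32 : P o4_3 o4_2 = 0 := off o4_3 o4_2 hC'.
pose Z := (z03, z13, z23, z30, z31, z32, S0).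
have kC (a b : R) : a != b -> a%:C != b%:C :> C by rewrite eq_realC.
have kC' (a b : R) : a != b -> b%:C != a%:C :> C by rewrite eq_realC eq_sym.
have z01 : P o4_0 o4_1 = 0.
  by apply: commute_zero (kC _ _ k12) _; entry eK o4_0 o4_1; rewrite !Z.
have z02 : P o4_0 o4_2 = 0.
  by apply: commute_zero (kC _ _ k13) _; entry eK o4_0 o4_2; rewrite !Z.
have z12 : P o4_1 o4_2 = 0.
  by apply: commute_zero (kC _ _ k23) _; entry eK o4_1 o4_2; rewrite !Z.
have z10 : P o4_1 o4_0 = 0.
  by apply: commute_zero (kC' _ _ k12) _; entry eK o4_1 o4_0; rewrite !Z.
have z20 : P o4_2 o4_0 = 0.
  by apply: commute_zero (kC' _ _ k13) _; entry eK o4_2 o4_0; rewrite !Z.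
have z21 : P o4_2 o4_1 = 0.
  by apply: commute_zero (kC' _ _ k23) _; entry eK o4_2 o4_1; rewrite !Z.
pose Y := (z01, z02, z12, z10, z20, z21, Z).
have bC (b : R) x y : b != 0 -> b%:C * x = y * b%:C -> y = x :> C.
  by move=> b0 e; apply: (@mulIf _ b%:C); rewrite ?eq_realC // -e mulrC.
have e0 : P o4_0 o4_0 = P o4_3 o4_3.
  by apply: bC b1N _; entry eK o4_0 o4_3; rewrite !Y.
have e1 : P o4_1 o4_1 = P o4_3 o4_3.
  by apply: bC b2N _; entry eK o4_1 o4_3; rewrite !Y.
have e2 : P o4_2 o4_2 = P o4_3 o4_3.
  by apply: bC b3N _; entry eK o4_2 o4_3; rewrite !Y.
apply/is_scalar_mxP; exists (P o4_3 o4_3); apply/matrixP.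
by do 2![apply: forall4P]; rewrite mxE /=.
Qed.

Lemma formB_conditions (h1 h2 k1 k2 k3 k4 b1 b2 b3 : R) :
  trivial_commutant (diag4 h1%:C h1%:C h1%:C h2%:C)
    (formB k1 k2 k3 k4 b1 b2 b3) ->
  [/\ k1 != k2, k1 != k3 & k2 != k3] /\ [/\ b1 != 0, b2 != 0 & b3 != 0].
Proof.
move=> triv.
have conn (S : pred 'I_4) :
    (forall i j, formB k1 k2 k3 k4 b1 b2 b3 i j != 0 ->
      S i = S j) -> forall i j, S i = S j.
  by move: triv; rewrite diag4_seq; exact: trivial_commutant_connected.
have b1N : b1 != 0.
  apply/eqP => b0.
  suff /(_ o4_0 o4_1) : forall i j : 'I_4, (i == o4_0) = (j == o4_0) by [].
  by apply: conn; do 2![apply: forall4P]; rewrite mxE /= ?b0 ?eqxx.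
have b2N : b2 != 0.
  apply/eqP => b0.
  suff /(_ o4_0 o4_1) : forall i j : 'I_4, (i == o4_1) = (j == o4_1) by [].
  by apply: conn; do 2![apply: forall4P]; rewrite mxE /= ?b0 ?eqxx.
have b3N : b3 != 0.
  apply/eqP => b0.
  suff /(_ o4_0 o4_2) : forall i j : 'I_4, (i == o4_2) = (j == o4_2) by [].
  by apply: conn; do 2![apply: forall4P]; rewrite mxE /= ?b0 ?eqxx.
have sH : (diag4 h1%:C h1%:C h1%:C h2%:C)^T = diag4 h1%:C h1%:C h1%:C h2%:C.
  by apply/matrixP; do 2![apply: forall4P]; rewrite !mxE.
have sK : (formB k1 k2 k3 k4 b1 b2 b3)^T = formB k1 k2 k3 k4 b1 b2 b3.
  by apply/matrixP; do 2![apply: forall4P]; rewrite !mxE.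
(* For equal eigenvalues of the 3 x 3 block, the vector orthogonal to [b] in
   their span is an eigenvector of both matrices. *)
pose vec (v1 v2 v3 : R) : 'cV[C]_4 :=
  mx_of_rows 4 1 [:: [:: v1%:C]; [:: v2%:C]; [:: v3%:C]; [:: 0]].
have eig (v1 v2 v3 k : R) :
    formB k1 k2 k3 k4 b1 b2 b3 *m vec v1 v2 v3 = k%:C *: vec v1 v2 v3 ->
    forall i j : 'I_4, i != j -> vec v1 v2 v3 i 0 * vec v1 v2 v3 j 0 = 0.
  move=> Kv.
  apply: (trivial_commutant_eigenvector (h := h1%:C) triv sH sK _ Kv).
  by apply/colP; apply: forall4P; rewrite !mxE sum4 !mxE /=; ring.
have bb (b b' : R) : b != 0 -> b' != 0 -> b%:C * (- b')%:C <> 0 :> C.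
  by move=> b0 b0'; apply/eqP; rewrite -rmorphM eq_realC mulf_neq0 ?oppr_eq0.
split=> //; split; apply/eqP => kk.
- suff Kv :
      formB k1 k2 k3 k4 b1 b2 b3 *m vec b2 (- b1) 0 = k1%:C *: vec b2 (- b1) 0.
    by have := eig _ _ _ _ Kv o4_0 o4_1 isT; rewrite !mxE; exact: bb.
  by apply/colP; apply: forall4P; rewrite !mxE sum4 !mxE /= ?kk; ring.
- suff Kv :
      formB k1 k2 k3 k4 b1 b2 b3 *m vec b3 0 (- b1) = k1%:C *: vec b3 0 (- b1).
    by have := eig _ _ _ _ Kv o4_0 o4_2 isT; rewrite !mxE; exact: bb.
  by apply/colP; apply: forall4P; rewrite !mxE sum4 !mxE /= ?kk; ring.
- suff Kv :
      formB k1 k2 k3 k4 b1 b2 b3 *m vec 0 b3 (- b2) = k2%:C *: vec 0 b3 (- b2).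
    by have := eig _ _ _ _ Kv o4_1 o4_2 isT; rewrite !mxE; exact: bb.
  by apply/colP; apply: forall4P; rewrite !mxE sum4 !mxE /= ?kk; ring.
Qed.

End FormB.

(** * Unitary reduction to the two forms *)

Section Reduction.
Context {R : realType}.
Local Notation C := R[i].

Lemma similar_cartesian n (U H K : 'M[C]_n) : U \is unitarymx ->
  U^t* *m H *m U = H ->
  unitarily_similar (H + 'i%C *: K) (H + 'i%C *: (U^t* *m K *m U)).
Proof.
move=> uU UH; exists U => //.
by rewrite mulmxDr mulmxDl UH -scalemxAr -scalemxAl.
Qed.

Lemma hermitian_conj n (U K : 'M[C]_n) : K \is hermsymmx ->
  U^t* *m K *m U \is hermsymmx.
Proof.
rewrite !hermE => /eqP hK; apply/eqP.
by rewrite (adjM (U^t* *m K)) (adjM (U^t* )) trmxCK -hK mulmxA.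
Qed.

Definition block_diag m n (U : 'M[C]_m) (V : 'M[C]_n) : 'M[C]_(m + n) :=
  block_mx U 0 0 V.

Lemma adj_block m n (A : 'M[C]_m) B B' (D : 'M[C]_n) :
  (block_mx A B B' D)^t* = block_mx (A^t* ) (B'^t* ) (B^t* ) (D^t* ).
Proof. by rewrite tr_block_mx map_block_mx. Qed.

Lemma block_diag_conj m n (U : 'M[C]_m) (V : 'M[C]_n) A B B' D :
  (block_diag U V)^t* *m block_mx A B B' D *m block_diag U V =
  block_mx (U^t* *m A *m U) (U^t* *m B *m V) (V^t* *m B' *m U) (V^t* *m D *m V).
Proof.
rewrite /block_diag adj_block !trmx0 !map_mx0 !mulmx_block.
by rewrite !mul0mx !mulmx0 !addr0 !add0r.
Qed.

Lemma block_diag_unitary m n (U : 'M[C]_m) (V : 'M[C]_n) :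
  U \is unitarymx -> V \is unitarymx -> block_diag U V \is unitarymx.
Proof.
move=> /unitarymxP UU /unitarymxP VV; apply/unitarymxP.
rewrite /block_diag adj_block !trmx0 !map_mx0 mulmx_block.
by rewrite !mul0mx !mulmx0 !addr0 !add0r UU VV -scalar_mx_block.
Qed.

Lemma block_diag_scalar m n (a b : C) (U : 'M[C]_m) (V : 'M[C]_n) :
  U \is unitarymx -> V \is unitarymx ->
  (block_diag U V)^t* *m block_mx a%:M 0 0 b%:M *m block_diag U V =
  block_mx a%:M 0 0 b%:M.
Proof.
move=> uU uV; rewrite block_diag_conj !mulmx0 !mul0mx !mul_mx_scalar.
by rewrite -!scalemxAl !unitarymx_mulC // !scalemx1.
Qed.

Lemma form_aE (h1 h2 : R) H K : form_a h1 h2 H K <->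
  exists (k11 k22 k33 k44 k12 k34 : C) (s1 s2 : R),
  [/\ H = diag4 h1%:C h1%:C h2%:C h2%:C,
      K = formA k11 k22 k33 k44 k12 k34 s1 s2,
      [/\ 0 < s1, s2 <= s1 & 0 <= s2] &
      [/\ s2 = 0 -> k12 * k34 != 0,
          s1 = s2 -> ~ comm_mx (mx2 k11 k12 k12^* k22) (mx2 k33 k34 k34^* k44) &
          s2 < s1 -> 0 < s2 -> k12 != 0 \/ k34 != 0]].
Proof.
split=> -[k11 [k22 [k33 [k44 [k12 [k34 [s1 [s2 [HE KE c1 c2]]]]]]]]];
  exists k11, k22, k33, k44, k12, k34, s1, s2; split=> //.
- by rewrite HE -scalar_mx4_block.
- rewrite KE; exact: block2_mx.
- by rewrite HE scalar_mx4_block.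
- rewrite KE; exact/esym/block2_mx.
Qed.

Lemma form_bE (h1 h2 : R) H K : form_b h1 h2 H K <->
  exists k1 k2 k3 k4 b1 b2 b3 : R,
  [/\ H = diag4 h1%:C h1%:C h1%:C h2%:C, K = formB k1 k2 k3 k4 b1 b2 b3,
      [/\ k1 != k2, k1 != k3 & k2 != k3] & [/\ b1 != 0, b2 != 0 & b3 != 0]].
Proof.
have e1 : map_mx (real_complex R)
    (mx_of_rows 4 4 [:: [:: h1; 0; 0; 0]; [:: 0; h1; 0; 0];
      [:: 0; 0; h1; 0]; [:: 0; 0; 0; h2]]) = diag4 h1%:C h1%:C h1%:C h2%:C.
  by apply/matrixP; do 2![apply: forall4P]; rewrite !mxE.
have e2 k1 k2 k3 k4 b1 b2 b3 : map_mx (real_complex R)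
    (mx_of_rows 4 4 [:: [:: k1; 0; 0; b1]; [:: 0; k2; 0; b2];
      [:: 0; 0; k3; b3]; [:: b1; b2; b3; k4]]) = formB k1 k2 k3 k4 b1 b2 b3.
  by apply/matrixP; do 2![apply: forall4P]; rewrite !mxE.
by split=> -[k1 [k2 [k3 [k4 [b1 [b2 [b3 [HE KE c1 c2]]]]]]]];
  exists k1, k2, k3, k4, b1, b2, b3; split=> //; rewrite ?HE ?KE ?e1 ?e2.
Qed.

Lemma hermitian_entry n (K : 'M[C]_n) i j :
  K \is hermsymmx -> K i j = (K j i)^*.
Proof. by rewrite hermE => /eqP {1}->; rewrite !mxE. Qed.

(** A block diagonal unitary commutes with [H]; its blocks are taken from a
    singular value decomposition of the off-diagonal block of [K]. *)
Lemma form_a_reduction (h1 h2 : R) (K : 'M[C]_4)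
  (H := diag4 h1%:C h1%:C h2%:C h2%:C) :
  K \is hermsymmx -> unitarily_irreducible (H + 'i%C *: K) ->
  H \is hermsymmx ->
  exists K' : 'M[C]_4, [/\ unitarily_similar (H + 'i%C *: K) (H + 'i%C *: K'),
    K' \is hermsymmx & form_a h1 h2 H K'].
Proof.
move=> hK irr hH.
pose K0 : 'M[C]_(2 + 2) := K.
have [U [V [uU uV [s1 [s2 [s20 s21 svd]]]]]] := svd2 (ursubmx K0).
have uW := block_diag_unitary uU uV; set W := block_diag U V in uW.
pose K' : 'M[C]_4 := W^t* *m K *m W.
have hK' : K' \is hermsymmx by exact: hermitian_conj.
have sim : unitarily_similar (H + 'i%C *: K) (H + 'i%C *: K').
  apply: similar_cartesian => //.
  have := block_diag_scalar h1%:C h2%:C uU uV.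
  by rewrite -[X in _ *m X *m _ = _](scalar_mx4_block h1%:C)
             -[RHS](scalar_mx4_block h1%:C).
have K'E : K' = block_mx (U^t* *m ulsubmx K0 *m U) (mx2 s1%:C 0 0 s2%:C)
    (V^t* *m dlsubmx K0 *m U) (V^t* *m drsubmx K0 *m V) :> 'M[C]_(2 + 2).
  by rewrite /K' -svd -block_diag_conj submxK.
exists K'; split=> //; apply/form_aE.
move: (U^t* *m ulsubmx K0 *m U) (V^t* *m dlsubmx K0 *m U)
  (V^t* *m drsubmx K0 *m V) K'E => X Y Z.
rewrite (mx2E X) (mx2E Y) (mx2E Z) block2_mx => K'E.
exists (X o2_0 o2_0), (X o2_1 o2_1), (Z o2_0 o2_0), (Z o2_1 o2_1),
  (X o2_0 o2_1), (Z o2_0 o2_1), s1, s2.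
have KF : K' = formA (X o2_0 o2_0) (X o2_1 o2_1) (Z o2_0 o2_0) (Z o2_1 o2_1)
  (X o2_0 o2_1) (Z o2_0 o2_1) s1 s2.
  have hE i j := hermitian_entry i j hK'.
  rewrite K'E in hE *; apply/matrixP.
  do 2![apply: forall4P]; rewrite [RHS]mxE /=;
    by [rewrite mxE | rewrite hE mxE /= | rewrite hE mxE /= rmorph0
       | rewrite hE mxE; exact: conjc_real].
have triv : trivial_commutant H K'.
  apply/(irreducible_cartesianP hH hK').
  exact: irreducible_similar sim irr.
rewrite KF in triv.
by have [s10 c1 c2 c3] := formA_conditions s21 s20 triv; split.
Qed.

Lemma diag_mx_conj n (d phi : 'rV[C]_n) :
  (forall i, phi 0 i * (phi 0 i)^* = 1) ->
  (diag_mx phi)^t* *m diag_mx d *m diag_mx phi = diag_mx d.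
Proof.
move=> phi1; rewrite tr_diag_mx map_diag_mx !mulmx_diag; congr diag_mx.
apply/rowP => i; rewrite !mxE mulrAC [_^* * _]mulrC phi1; exact: mul1r.
Qed.

Lemma diag_mx_unitary n (phi : 'rV[C]_n) :
  (forall i, phi 0 i * (phi 0 i)^* = 1) -> diag_mx phi \is unitarymx.
Proof.
move=> phi1; apply/unitarymxP; rewrite tr_diag_mx map_diag_mx mulmx_diag.
by apply/matrixP => i j; rewrite !mxE phi1.
Qed.

(** The eigenvectors in an orthonormal basis are determined up to phases, and
    the phases can be chosen so that the coordinates of [b] equal their
    absolute values. *)
Lemma hermitian_diagonalize_phases n (A : 'M[C]_n) (b : 'cV[C]_n) :
  A \is hermsymmx -> exists2 W : 'M[C]_n, W \is unitarymx &
  exists d : 'rV[C]_n, W^t* *m A *m W = diag_mx d /\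
    forall i, (W^t* *m b) i 0 \is Num.real.
Proof.
move=> hA; have uP := spectral_unitarymx A; set P := spectralmx A in uP.
have AE := orthomx_spectralP (hermitian_normalmx hA); rewrite -/P in AE.
have h i : exists w : C, w * w^* = 1 /\ w^* * (P *m b) i 0 = `|(P *m b) i 0|.
  by have [w w1 w2] := phase ((P *m b) i 0); exists w.
have [w wP] := choice h.
pose phi := \row_i w i; have phi1 i : phi 0 i * (phi 0 i)^* = 1.
  by rewrite mxE; have [] := wP i.
have uPs : P^t* \is unitarymx by rewrite trmxC_unitary.
exists (P^t* *m diag_mx phi).
  exact: (mul_unitarymx uPs (diag_mx_unitary phi1)).
exists (spectral_diag A); rewrite (adjM (P^t* )) trmxCK; split=> [|i].
  have PA : P *m A *m P^t* = diag_mx (spectral_diag A).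
    rewrite [X in P *m X]AE invmx_unitary // !mulmxA (unitarymxP uP) mul1mx.
    by rewrite -mulmxA (unitarymxP uP) mulmx1.
  by rewrite -[RHS](diag_mx_conj _ phi1) -PA !mulmxA.
rewrite -mulmxA tr_diag_mx map_diag_mx mul_diag_mx mxE [X in X * _]mxE mxE.
by have [_ ->] := wP i; exact: normr_real.
Qed.

(** The unitary matrix acts on the first three coordinates, by
    [hermitian_diagonalize_phases] for the corner of [K] and its last column. *)
Lemma form_b_reduction (h1 h2 : R) (K : 'M[C]_4)
  (H := diag4 h1%:C h1%:C h1%:C h2%:C) :
  K \is hermsymmx -> unitarily_irreducible (H + 'i%C *: K) ->
  H \is hermsymmx ->
  exists K' : 'M[C]_4, [/\ unitarily_similar (H + 'i%C *: K) (H + 'i%C *: K'),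
    K' \is hermsymmx & form_b h1 h2 H K'].
Proof.
move=> hK irr hH.
pose K0 : 'M[C]_(3 + 1) := K.
have hA : ulsubmx K0 \is hermsymmx.
  rewrite hermE; apply/eqP/matrixP => i j; rewrite !mxE.
  exact: (hermitian_entry _ _ hK).
have [W uW [d [Wd Wb]]] := hermitian_diagonalize_phases (ursubmx K0) hA.
have u1 : (1%:M : 'M[C]_1) \is unitarymx.
  by apply/unitarymxP; rewrite trmx1 map_mx1 mulmx1.
have uU := block_diag_unitary uW u1; set U := block_diag W _ in uU.
pose K' : 'M[C]_4 := U^t* *m K *m U.
have hK' : K' \is hermsymmx by exact: hermitian_conj.
have HE : H = block_mx (h1%:C%:M : 'M[C]_3) 0 0 (h2%:C%:M : 'M[C]_1)
    :> 'M[C]_(3 + 1).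
  apply/matrixP; do 2![apply: (@forall4P)]; rewrite !mxE /=;
    case: splitP => -[[|[|[|//]]] i] //= _; rewrite !mxE /=;
    by case: splitP => -[[|[|[|//]]] j] //= _; rewrite !mxE.
have sim : unitarily_similar (H + 'i%C *: K) (H + 'i%C *: K').
  apply: similar_cartesian => //.
  by have := block_diag_scalar h1%:C h2%:C uW u1; rewrite -HE.
have K'E : K' = block_mx (diag_mx d) (W^t* *m ursubmx K0)
    (dlsubmx K0 *m W) (drsubmx K0) :> 'M[C]_(3 + 1).
  have := block_diag_conj W (1%:M : 'M[C]_1) (ulsubmx K0) (ursubmx K0)
    (dlsubmx K0) (drsubmx K0).
  by rewrite submxK Wd trmx1 map_mx1 !mul1mx !mulmx1.
have triv : trivial_commutant H K'.
  apply/(irreducible_cartesianP hH hK').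
  exact: irreducible_similar sim irr.
exists K'; split=> //; apply/form_bE.
pose L (i : 'I_3) : 'I_4 := lshift 1 i; pose T : 'I_4 := rshift 3 (0 : 'I_1).
have real_diag i : K' i i = (complex.Re (K' i i))%:C.
  by rewrite RRe_real //; apply/CrealP; rewrite -hermitian_entry.
have real_b i : K' (L i) T = (complex.Re (K' (L i) T))%:C.
  by rewrite RRe_real // K'E (@block_mxEur _ 3 1 3 1).
have real_b' i : K' T (L i) = (complex.Re (K' (L i) T))%:C.
  by rewrite (hermitian_entry _ _ hK') real_b; exact: conjc_real.
have zero i j : i != j -> K' (L i) (L j) = 0.
  by move=> /negbTE ij; rewrite K'E (@block_mxEul _ 3 1 3 1) mxE ij.
pose o3_0 := @Ordinal 3 0 isT; pose o3_1 := @Ordinal 3 1 isT.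
pose o3_2 := @Ordinal 3 2 isT.
have E0 : o4_0 = L o3_0 by exact/val_inj.
have E1 : o4_1 = L o3_1 by exact/val_inj.
have E2 : o4_2 = L o3_2 by exact/val_inj.
have E3 : o4_3 = T by exact/val_inj.
have KF : K' = formB (complex.Re (K' o4_0 o4_0)) (complex.Re (K' o4_1 o4_1))
    (complex.Re (K' o4_2 o4_2)) (complex.Re (K' o4_3 o4_3))
    (complex.Re (K' o4_0 o4_3)) (complex.Re (K' o4_1 o4_3))
    (complex.Re (K' o4_2 o4_3)).
  apply/matrixP; do 2![apply: forall4P]; rewrite [RHS]mxE /=;
    by first [exact: real_diag | rewrite ?E0 ?E1 ?E2 ?E3;
      first [exact: real_b | exact: real_b' | exact: zero]].
rewrite KF in triv; have [c1 c2] := formB_conditions triv.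
by do 7![eexists]; split; first reflexivity; [exact: KF| |].
Qed.

End Reduction.
(** * Directions with two extreme eigenvalues *)

Section Ordering.

Lemma extremal_two_valued (R : realType) (I : Type) (d : I -> R) i1 i2 :
  (forall j, (forall i, d i <= d j) \/ (forall i, d j <= d i)) ->
  d i1 != d i2 -> forall j, d j = d i1 \/ d j = d i2.
Proof.
move=> ext /eqP d12 j.
case: (ext j) (ext i1) (ext i2) => hj [h1|h1] [h2|h2];
  by [left; apply: le_anti; rewrite hj h1 | right; apply: le_anti; rewrite hj h2
     | case: d12; apply: le_anti; rewrite h1 h2].
Qed.

(** The value [h] is the one taken at least twice, so it fills two or three
    positions. *)
Lemma two_valued_ordering (R : realType) (d : 'I_4 -> R) (h1 h2 : R) i1 i2 :
  h1 != h2 -> (forall j, d j = h1 \/ d j = h2) -> d i1 = h1 -> d i2 = h2 ->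
  exists s : 'I_4 -> 'I_4, exists m h h', [/\ injective s, h != h',
    m = 2%N \/ m = 3%N & forall i, d (s i) = if (i < m)%N then h else h'].
Proof.
wlog big : h1 h2 i1 i2 / (2 <= #|[pred j | d j == h1]|)%N.
  move=> wl h12 dh d1 d2; have [|small] := leqP 2 #|[pred j | d j == h1]|.
    by move/wl; apply; eassumption.
  apply: (wl h2 h1 i2 i1) => //; rewrite 1?eq_sym //; last first.
    by move=> j; case: (dh j); [right | left].
  have -> : #|[pred j | d j == h2]| = #|[predC [pred j | d j == h1]]|.
    apply: eq_card => j; rewrite !inE; case: (dh j) => ->; rewrite eqxx.
      exact: negbTE.
    by rewrite eq_sym.
  rewrite -(leq_add2l #|[pred j | d j == h1]|) cardC card_ord addn2.
  by rewrite !ltnS ltnW.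
move=> h12 dh d1 d2.
pose S := [seq j <- enum 'I_4 | d j == h1].
pose T := [seq j <- enum 'I_4 | ~~ (d j == h1)].
pose m := size S.
have mE : m = #|[pred j | d j == h1]|.
  by rewrite cardE /m /S enumT.
have sz : size (S ++ T) = 4.
  by rewrite size_cat !size_filter count_predC size_enum_ord.
have u : uniq (S ++ T).
  by rewrite (perm_uniq (permEl (perm_filterC _ _))) enum_uniq.
have m3 : (m < 4)%N.
  have T0 : (0 < size T)%N.
    rewrite size_filter -has_count; apply/hasP; exists i2; rewrite ?mem_enum //.
    by rewrite d2 eq_sym.
  have : (m < size S + size T)%N by rewrite -[X in (X < _)%N]addn0 ltn_add2l.
  by rewrite -size_cat sz.
pose s (i : 'I_4) := nth i1 (S ++ T) i.
exists s, m, h1, h2; split=> //.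
- move=> i j /eqP; rewrite nth_uniq ?sz // => /eqP; exact: val_inj.
- move: big m3; rewrite -mE.
  by case: (m) => [|[|[|[|]]]] // _ _; [left | right].
move=> i; rewrite /s nth_cat -/m; case: ltnP => im.
  by have := mem_nth i1 im; rewrite mem_filter => /andP[/eqP].
have im' : (i - m < size T)%N.
  by rewrite ltn_subLR // -size_cat sz.
have := mem_nth i1 im'; rewrite mem_filter => /andP[].
by case: (dh (nth i1 T (i - m))) => -> //; rewrite eqxx.
Qed.

End Ordering.

Section GauWu.
Context {R : realType}.
Local Notation C := R[i].

Lemma gau_wu_fullP n (A : 'M[C]_n) : gau_wu A = n <->
  exists x : 'I_n -> 'cV[C]_n, boundary_family A x.
Proof.
rewrite /gau_wu; split=> [max|[x bx]]; last first.
  apply/eqP; rewrite eqn_leq; apply/andP; split.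
    by apply/bigmax_leqP => k _; rewrite -ltnS.
  apply: (@leq_bigmax_cond _ _ _ ord_max).
  by apply/asboolP; exists x.
apply: contrapT => no.
have n0 : (0 < n)%N.
  case: n A no {max} => // A []; exists (fun=> 0); split; first by case.
  by case.
have : (\max_(k < n.+1 |
    `[< exists x : 'I_k -> 'cV[C]_n, boundary_family A x >]) k <= n.-1)%N.
  apply/bigmax_leqP => k /asboolP kP.
  have : (k <= n)%N by rewrite -ltnS.
  rewrite leq_eqVlt => /orP[/eqP kn|]; last first.
    by rewrite -[X in (_ < X)%N](prednK n0).
  by move: kP; rewrite kn.
by rewrite max; case: n n0 {A max no} => // n _; rewrite ltnn.
Qed.

Lemma quad_hermitian_real n (K : 'M[C]_n) z : K \is hermsymmx ->
  quad K z \is Num.real.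
Proof. by rewrite hermE => /eqP hK; apply/CrealP; rewrite -quad_adj -hK. Qed.

Lemma Re_quad_cartesian n (H K : 'M[C]_n) z : H \is hermsymmx ->
  K \is hermsymmx -> (complex.Re (quad (H + 'i%C *: K) z))%:C = quad H z.
Proof.
move=> hH hK; rewrite quadDm quadZm.
rewrite -(RRe_real (quad_hermitian_real z hH)).
rewrite -(RRe_real (quad_hermitian_real z hK)).
by rewrite /= mul0r mulr0 subrr addr0.
Qed.

Lemma quad_diag n (d : 'rV[C]_n) z :
  quad (diag_mx d) z = \sum_i d 0 i * `|z i 0| ^+ 2.
Proof.
rewrite /quad innerE; apply: eq_bigr => i _.
by rewrite mul_diag_mx mxE normCK; ring.
Qed.

(** On the unit sphere [Re <(H + iK) z, z>] is a mean of the eigenvalues of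
    [H], so eigenvectors of its extreme eigenvalues lie over the boundary. *)
Lemma diagonal_maximizes n (d : 'I_n.+1 -> R) (K : 'M[C]_n.+1) c j
    (H := diag_mx (\row_i (d i)%:C)) :
  H \is hermsymmx -> K \is hermsymmx ->
  (forall i, c * d i <= c * d j) ->
  maximizes (H + 'i%C *: K) c%:C (delta_mx j 0).
Proof.
move=> hH hK ext z z1; rewrite !ReZ -lecR !rmorphM /= !Re_quad_cartesian //.
rewrite quad_delta mxE eqxx mxE mulr1n -rmorphM /= quad_diag mulr_sumr.
rewrite -[leRHS]mulr1 -z1 inner_normE mulr_sumr; apply: ler_sum => i _.
rewrite mxE mulrA ler_wpM2r ?exprn_ge0 //; by rewrite -rmorphM lecR.
Qed.

End GauWu.
(** * The classification *)

Section Classification.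
Context {R : realType}.
Local Notation C := R[i].

(** If the Hermitian part were the scalar [a], then [K] would lie in the
    commutant, hence be scalar too, and every matrix would. *)
Lemma irreducible_not_scalar n (a : C) (K : 'M[C]_n.+2) :
  (a%:M : 'M[C]_n.+2) \is hermsymmx -> K \is hermsymmx ->
  ~ unitarily_irreducible (a%:M + 'i%C *: K).
Proof.
move=> ha hK /(irreducible_cartesianP ha hK) triv.
have aP P : a%:M *m P = P *m a%:M :> 'M[C]_n.+2.
  by rewrite mul_scalar_mx mul_mx_scalar.
have /is_scalar_mxP[k KE] : is_scalar_mx K by apply: triv.
have /is_scalar_mxP[z] : is_scalar_mx (delta_mx 0 0 : 'M[C]_n.+2).
  by apply: triv => //; rewrite KE mul_scalar_mx mul_mx_scalar.
move=> /matrixP e; have := e 0 0; have := e 1 1.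
rewrite !mxE /= !mulr1n => <- /eqP.
by rewrite oner_eq0.
Qed.

Lemma maximizes_unitaryV n (A B U : 'M[C]_n.+1) c (theta : R) y :
  U \is unitarymx -> B = U^t* *m (expi theta *: A) *m U ->
  maximizes B c y -> maximizes A (c * expi theta) (U *m y).
Proof.
move=> uU BE max z z1; have UU := unitarymxP uU.
have q v : c * expi theta * quad A v = c * quad B (U^t* *m v).
  by rewrite BE quad_unitary mulmxA UU mul1mx quadZm mulrA.
rewrite !q mulmxA (unitarymx_mulC uU) mul1mx; apply: max.
by rewrite (inner_unitary _ _ (adj_unitary uU)).
Qed.

Lemma normal_form_forward (A : 'M[C]_4) :
  unitarily_irreducible A -> gau_wu A = 4%N ->
  exists (theta : R) (H K : 'M[C]_4),
    [/\ unitarily_similar (expi theta *: A) (H + 'i%C *: K),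
        H \is hermsymmx, K \is hermsymmx &
        exists h1 h2 : R, h1 != h2 /\ (form_a h1 h2 H K \/ form_b h1 h2 H K)].
Proof.
move=> irrA /gau_wu_fullP[x bx]; have [ox _] := bx.
have [theta ext] := boundary_basis_direction irrA bx.
pose d j := complex.Re (expi theta * quad A (x j)).
have irrT : unitarily_irreducible (expi theta *: A).
  exact: irreducible_scale (expi_neq0 theta) irrA.
have x1 j : inner (x j) (x j) = 1 by rewrite ox eqxx.
have dext j : (forall i, d i <= d j) \/ (forall i, d j <= d i).
  case: (ext j) => max; [left|right] => i; have := max (x i) (x1 i).
    exact.
  by rewrite !mulNr !ReN lerN2.
have [i1 [i2 d12]] : exists i1 i2, d i1 != d i2.
  apply: contrapT => const.
  have dE j : d j = d 0.
    by apply/eqP/negPn/negP => dj; apply: const; exists j, 0.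
  have [H [K [sim hH hK HE]]] := extremal_basis_diagonal ox ext.
  have HS : H = (d 0)%:C%:M.
    by rewrite HE; apply/matrixP => i j; rewrite !mxE -/(d i) (dE i).
  rewrite HS in sim hH; apply: (irreducible_not_scalar hH hK).
  exact: irreducible_similar sim irrT.
have d2 := extremal_two_valued dext d12.
have [s [m [h1 [h2 [sI h12 m23 ds]]]]] :=
  two_valued_ordering d12 d2 erefl erefl.
have oxs : Defs.orthonormal (x \o s).
  by move=> i j; rewrite /= ox (inj_eq sI).
have [H [K [sim hH hK HE]]] :=
  extremal_basis_diagonal oxs (fun j => ext (s j)).
have irr : unitarily_irreducible (H + 'i%C *: K).
  exact: irreducible_similar sim irrT.
have {}HE : H = diag4 (d (s o4_0))%:C (d (s o4_1))%:C
    (d (s o4_2))%:C (d (s o4_3))%:C.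
  by rewrite HE diag4E.
exists theta; case: m23 => mE;
  rewrite !ds mE /= in HE; rewrite HE in sim hH irr.
  have [K' [sim' hK' fa]] := form_a_reduction hK irr hH.
  exists (diag4 h1%:C h1%:C h2%:C h2%:C), K'.
  split; [exact: unitarily_similar_trans sim sim' | exact: hH | exact: hK' |].
  by exists h1, h2; split; [exact: h12 | left].
have [K' [sim' hK' fb]] := form_b_reduction hK irr hH.
exists (diag4 h1%:C h1%:C h1%:C h2%:C), K'.
split; [exact: unitarily_similar_trans sim sim' | exact: hH | exact: hK' |].
by exists h1, h2; split; [exact: h12 | right].
Qed.

(** The columns of the unitary matrix that realises the similarity are
    eigenvectors of the Hermitian part of [expi theta *: A] for its extreme
    eigenvalues. *)
Lemma normal_form_backward (A H K : 'M[C]_4) (theta : R) (d : 'I_4 -> R) :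
  unitarily_similar (expi theta *: A) (H + 'i%C *: K) ->
  H \is hermsymmx -> K \is hermsymmx -> H = diag_mx (\row_i (d i)%:C) ->
  (forall j, (forall i, d i <= d j) \/ (forall i, d j <= d i)) ->
  trivial_commutant H K -> unitarily_irreducible A /\ gau_wu A = 4%N.
Proof.
move=> sim hH hK HE ext triv; have t0 := expi_neq0 theta.
have irr : unitarily_irreducible (H + 'i%C *: K).
  exact/(irreducible_cartesianP hH hK).
have irrT := irreducible_similar (unitarily_similar_sym sim) irr.
split.
  have := irreducible_scale (invr_neq0 t0) irrT.
  by rewrite scalerA mulVf // scale1r.
apply/gau_wu_fullP; have [U uU BE] := sim.
exists (fun j => U *m delta_mx j 0); split=> [i j|j].
  by rewrite inner_unitary // inner_delta.
have Ue1 : inner (U *m delta_mx j 0) (U *m delta_mx j 0) = 1.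
  by rewrite inner_unitary // inner_delta eqxx.
have [c c0 dc] : exists2 c : R, c != 0 & forall i, c * d i <= c * d j.
  case: (ext j) => dj; [exists 1 | exists (-1)] => [|i||i];
    rewrite ?oppr_eq0 ?oner_eq0 //.
    by rewrite !mul1r.
  by rewrite !mulN1r lerN2.
apply: (maximizes_boundary (c := c%:C * expi theta) Ue1).
  by rewrite mulf_neq0 // eq_realC.
apply: (maximizes_unitaryV uU BE); rewrite HE.
by apply: (diagonal_maximizes _ hK dc); rewrite -HE.
Qed.

End Classification.

Theorem theorem12 (R : realType) (A : 'M[R[i]]_4) :
  (unitarily_irreducible A /\ gau_wu A = 4%N) <->
  exists (theta : R) (H K : 'M[R[i]]_4),
    [/\ unitarily_similar (expi theta *: A) (H + 'i%C *: K),
        H \is hermsymmx, K \is hermsymmx &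
        exists h1 h2 : R,
          h1 != h2 /\ (form_a h1 h2 H K \/ form_b h1 h2 H K)].
Proof.
split=> [[irrA kA]|[theta [H [K [sim hH hK [h1 [h2 [h12 form]]]]]]]].
  exact: normal_form_forward.
case: form => [/form_aE|/form_bE].
  move=> [k11 [k22 [k33 [k44 [k12 [k34 [s1 [s2]]]]]]]].
  move=> [HE KE [s10 s21 s20] [c1 c2 c3]].
  pose d (i : 'I_4) := if (i < 2)%N then h1 else h2.
  apply: (normal_form_backward (d := d) sim hH hK).
  - by rewrite HE diag4E.
  - move=> j; have [le|/ltW le] := leP h1 h2; rewrite /d.
      by case: (j < 2)%N; [right | left] => i; case: (i < 2)%N.
    by case: (j < 2)%N; [left | right] => i; case: (i < 2)%N.
  by rewrite HE KE; exact: formA_commutant.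
move=> [k1 [k2 [k3 [k4 [b1 [b2 [b3 [HE KE c1 c2]]]]]]]].
pose d (i : 'I_4) := if (i < 3)%N then h1 else h2.
apply: (normal_form_backward (d := d) sim hH hK).
- by rewrite HE diag4E.
- move=> j; have [le|/ltW le] := leP h1 h2; rewrite /d.
    by case: (j < 3)%N; [right | left] => i; case: (i < 3)%N.
  by case: (j < 3)%N; [left | right] => i; case: (i < 3)%N.
by rewrite HE KE; exact: formB_commutant.
Qed.
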